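(* Let $(\Omega,\mathcal F,(\mathcal F_A)_{A\in\mathcal A},\mathbb P)$ be a complete probability space with a set-indexed filtration, let $X=\{X_A;A\in\mathcal A\}$ be an $E$-valued $\mathcal C$-Feller process w.r.t. $(\mathcal F_A)_{A\in\mathcal A}$, and let $\xi$ be a bounded simple stopping set. Moreover, suppose $X$ has outer-continuous sample paths and is homogeneous w.r.t. a collection of shift operators $(\theta_U)_{U\in\mathcal A}$. Then $X$ satisfies the strong $\mathcal C$-Markov property $$\mathbb E_\nu[f(X\circ\theta_\xi)\mid\widetilde{\mathcal F}_\xi]=\mathbb E_{X_\xi}[f(X)]\quad\mathbb P_\nu\text{-a.s.}$$ for any initial measure $\nu$ and any measurable function $f:E^{\mathcal A}\to\mathbf R_+$.
   Context: Indexing collection. $\mathcal T$ is a locally compact metric space and $(E,d_E)$ is a locally compact separable metric space with Borel $\sigma$-field $\mathcal E$. The indexing collection $\mathcal A$ is a class of compact subsets of $\mathcal T$ such that: (i) $\mathcal A$ is closed under arbitrary intersections and $A^\circ\neq A$ for all $A\in\mathcal A$, $A\neq\mathcal T$; (ii) $\emptyset':=\bigcap_{A\in\mathcal A}A$ is nonempty; (iii) there is an increasing sequence $(B_n)_{n\in\mathbf N}$ in $\mathcal A$ with $\mathcal T=\bigcup_nB_n$; (iv) (Shape) if $A,A_1,\dots,A_k\in\mathcal A$ and $A\subseteq\bigcup_{i=1}^kA_i$ then $A\subseteq A_i$ for some $i$. Increments. $\mathcal A(u)$ is the class of (nonempty) finite unions of sets of $\mathcal A$, and $\mathcal C$ is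 the class of increments $C=A\setminus B$, $A\in\mathcal A$, $B\in\mathcal A(u)$. To $C$ one associates $A$ and $B$ with $C=A\setminus B$, $B\subseteq A$, $B=\bigcup_{i=1}^kA_i$ being the extremal representation ($A_i\in\mathcal A$, $A_i\not\subseteq A_j$ for $i\ne j$). Let $\mathcal A_\ell$ be the set of all intersections of nonempty subfamilies of $\{A_1,\dots,A_k\}$, and $\mathcal A_C=\{U\in\mathcal A_\ell;\ U\not\subseteq B^\circ\}=\{U_C^1,\dots,U_C^p\}$, $p=|\mathcal A_C|$. For a process $X$, $\mathbf X_C=(X_{U_C^1},\dots,X_{U_C^p})$; similarly $\mathbf x_C=(x_{U_C^1},\dots,x_{U_C^p})\in E^{|\mathcal A_C|}$. Separability from above. It is assumed that there exist an increasing sequence of finite subclasses $\mathcal A_n=\{A^n_1,\dots,A^n_{k_n}\}$ of $\mathcal A$ closed under intersections with $B_n\in\mathcal A_n$, a sequence $\varepsilon_n\downarrow0$, and functions $g_n:\mathcal A\to\mathcal A_n\cup\{\mathcal T\}$ such that: (i) $A=\bigcap_ng_n(A)$ for all $A\in\mathcal A$; (ii) $g_n$ preserves arbitrary intersections and finite unions; (iii) $A\subseteq(g_n(A))^\circ$; (iv) $g_n(A)\subseteq g_m(A)$ if $n\ge m$; (v) $d_H(A,g_n(A))\le\varepsilon_n$ whenever $g_n(A)\subseteq B_n$, where $d_H$ is the Hausdorff distance. Filtrations. For a filtration $(\mathcal F_A)_{A\in\mathcal A}$ (increasing, always supposed complete), $\mathcal F_B=\bigvee_{A\in\mathcal A,A\subseteq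 B}\mathcal F_A$ for $B\in\mathcal A(u)$ (and $B=\mathcal T$), and $\mathcal G^*_C=\bigvee_{B\in\mathcal A(u),\,B\cap C=\emptyset}\mathcal F_B$ for $C\in\mathcal C$. The augmented filtration is $\widetilde{\mathcal F}_A=\bigcap_n\mathcal F_{g_n(A)}$, $A\in\mathcal A$, extended by $\widetilde{\mathcal F}_B=\bigvee_{A\in\mathcal A,A\subseteq B}\widetilde{\mathcal F}_A$, $B\in\mathcal A(u)$. $\mathcal C$-Markov property. An $E$-valued process $X$ is $\mathcal C$-Markov w.r.t. $(\mathcal F_A)$ if it is adapted and, for all $C=A\setminus B\in\mathcal C$ and all bounded measurable $f:E\to\mathbf R$, $\mathbb E[f(X_A)\mid\mathcal G^*_C]=\mathbb E[f(X_A)\mid\mathbf X_C]$ a.s. Its $\mathcal C$-transition system is $P_C(\mathbf x_C;\Gamma)=\mathbb P(X_A\in\Gamma\mid\mathbf X_C=\mathbf x_C)$. $\mathcal C$-transition system. A collection $\mathcal P=\{P_C(\mathbf x_C;\mathrm dx_A);C\in\mathcal C\}$ such that: 1. each $P_C$ is a transition probability from $E^{|\mathcal A_C|}$ to $(E,\mathcal E)$; 2. $P_\emptyset(x;\Gamma)=\delta_x(\Gamma)$; 3. for all $C=A\setminus B\in\mathcal C$ and $A'\in\mathcal A$, with $C'=C\cap A'$ and $C''=C\setminus A'$, $P_C(\mathbf x_C;\Gamma)=\int_EP_{C'}(\mathbf x_{C'};\mathrm dx_{A'})P_{C''}(\mathbf x_{C''};\Gamma)$ for all $\mathbf x_C,\mathbf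 x_{C'},\mathbf x_{C''}$, $\Gamma\in\mathcal E$. Components of the three vectors indexed by the same set are equal; when $A'\subseteq A$, $A'\not\subseteq B$ one has $A'\in\mathcal A_{C''}$ and the component $x_{A'}$ of $\mathbf x_{C''}$ is the integration variable; if $A'\subseteq B$ or $A\subseteq A'$ the equation is trivial; if $A'\not\subseteq A$ read $A\cap A'$ for $A'$. Write $P_Cf(\mathbf x_C)=\int_EP_C(\mathbf x_C;\mathrm dx_A)f(x_A)$. Pseudo-norms. For $C=A\setminus B$, number $B=\bigcup_{i=1}^kA_i$ so that $d_H(A,A_1)\le\dots\le d_H(A,A_k)$, put $U_C^0=A$, $U_C^1=A_1$, and define $\psi_C:\{U_C^0,\dots,U_C^p\}\to\{U_C^1,\dots,U_C^p\}$ by: $\psi_C(U_C^0)=\psi_C(U_C^1)=A_1$; inductively, for $i\in\{2,\dots,p\}$ not yet treated, there is $j>i$ with $A_1\cap U_C^j=A_1\cap U_C^i$ (the corresponding terms cancelling each other in $X_{A_1}=\sum_{i=1}^p(-1)^{\varepsilon_i}X_{A_1\cap U_C^i}$, where $(-1)^{\varepsilon_i}$ is the sign of $X_{U_C^i}$ in the inclusion–exclusion formula for $B$), and one sets $\psi_C(U_C^i)=\psi_C(U_C^j)=U_C^j$. Then $\|C\|_{\mathcal C}=\max_{0\le i\le p}d_H(U_C^i,\psi_C(U_C^i))$ and $\|\mathbf x_C\|_{\mathcal C}=\max_{0\le i\le p}d_E(x_{U_C^i},x_{\psi_C(U_C^i)})$ (the latter also involving $x_{U_C^0}=x_A$). For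 $m\in\mathbf N$, $\mathcal C^m=\{C\in\mathcal C:|\mathcal A_C|\le m,\ C\subseteq B_m\}$. $\mathcal C$-Feller. $\mathcal P$ is Feller if: 1. for all $f\in C_0(E)$ and $C\in\mathcal C$, $P_Cf\in C_0(E^{|\mathcal A_C|})$ ($C_0$: continuous functions vanishing at infinity); 2. for all $f\in C_0(E)$ and $m\in\mathbf N$, $$\lim_{\rho\to0}\ \sup_{C=C'\cup C''\in\mathcal C^m,\ \|C'\|_{\mathcal C}\le\rho}\ \sup_{\mathbf x_{C''},\mathbf x_{C'}:\ \|\mathbf x_{C'}\|_{\mathcal C}\le\rho}|P_Cf(\mathbf x_C)-P_{C''}f(\mathbf x_{C''})|=0,$$ where $C'=C\cap A'$, $C''=C\setminus A'$ with $A'\in\mathcal A$. A $\mathcal C$-Markov process is $\mathcal C$-Feller if its $\mathcal C$-transition system is Feller. Outer-continuity. $X$ has outer-continuous sample paths if for all $A\in\mathcal A$ and $\varepsilon>0$ there is $\alpha>0$ such that $A\subseteq U\in\mathcal A$ and $d_H(A,U)\le\alpha$ imply $d_E(X_A,X_U)\le\varepsilon$. Shift operators and homogeneity. $(\theta_U)_{U\in\mathcal A}$ is a collection of maps $\theta_U:\mathcal A\to\mathcal A$ such that: (i) if $U^\circ\ne\emptyset$, $A\subset(\theta_U(A))^\circ$ for all $A\in\mathcal A$; (ii) for any $A\in\mathcal A$, $U\mapsto\theta_U(A)$ is increasing and monotone outer-continuous, with $\theta_{\emptyset'}(A)=A$; (iii) $\theta_U$ is stable under intersections and $\theta_U(\emptyset')=U$.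 They are extended by $\theta_U(B)=\bigcup_i\theta_U(A_i)$ for $B=\bigcup_iA_i\in\mathcal A(u)$ and $\theta_U(C)=\theta_U(A)\setminus\theta_U(B)$ for $C=A\setminus B\in\mathcal C$. $X$ (or $\mathcal P$) is homogeneous w.r.t. $(\theta_U)$ if for all $U\in\mathcal A$ and $C=A\setminus B\in\mathcal C$, $P_C(\mathbf x_C;\mathrm dx_A)=P_{\theta_U(C)}(\mathbf x_{\theta_U(C)};\mathrm dx_{\theta_U(A)})$, the component of index $V$ of $\mathbf x_C$ being identified with the component of index $\theta_U(V)$ of $\mathbf x_{\theta_U(C)}$. $X\circ\theta_\xi$ is the process $A\mapsto X_{\theta_\xi(A)}$. Stopping sets. A simple stopping set is a random variable $\xi:\Omega\to\mathcal A$ with $\{\omega:A\subseteq\xi(\omega)\}\in\mathcal F_A$ for all $A\in\mathcal A$; it is bounded if $\xi\subseteq V$ a.s. for some $V\in\mathcal A$. $\widetilde{\mathcal F}_\xi=\{F\in\mathcal F:F\cap\{\xi\subseteq B\}\in\widetilde{\mathcal F}_B\ \forall B\in\mathcal A(u)\}$. Notation $\mathbb P_\nu$. For a probability measure $\nu$ on $(E,\mathcal E)$, $\mathbb P_\nu$ is the probability under which $X$ is $\mathcal C$-Markov w.r.t. $(\mathcal F_A)$ with $\mathcal C$-transition system $\mathcal P$ and initial law $X_{\emptyset'}\sim\nu$; $\mathbb E_\nu$ is the corresponding expectation, $\mathbb E_x=\mathbb E_{\delta_x}$, and $\mathbb E_{X_\xi}[f(X)]$ is $x\mapsto\mathbb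 E_x[f(X)]$ evaluated at $X_\xi$. *)

(* Defs.v *)
From HB Require Import structures.
From mathcomp Require Import all_boot all_order all_algebra.
From mathcomp Require Import all_classical all_reals all_analysis.
From mathcomp Require Import measurable_realfun.
Set Implicit Arguments.
Unset Strict Implicit.
Unset Printing Implicit Defensive.
Import Order.TTheory GRing.Theory Num.Theory.
Import numFieldNormedType.Exports.
Local Open Scope classical_set_scope.
Local Open Scope ring_scope.

(* Nonempty metric spaces: measurable types are pointed in the library. *)
#[short(type="pmetricType")]
HB.structure Definition PointedMetric (K : numDomainType) :=
  { M of Metric K M & isPointed M }.

Definition separable (X : topologicalType) : Prop :=
  exists D : set X, countable D /\ dense D.

Definition hausdorff_dist (R : realType) (T : metricType R) (A B : set T) : R :=
  inf [set e : R | [/\ 0 <= e,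
    forall x, A x -> exists2 y, B y & mdist x y <= e &
    forall y, B y -> exists2 x, A x & mdist y x <= e]].

Definition C0 (R : realType) (X : topologicalType) (f : X -> R) : Prop :=
  continuous f /\
  forall e : R, 0 < e ->
    exists2 K : set X, compact K & forall x, ~ K x -> `|f x| < e.

Section Indexing.
Context (R : realType) (T : metricType R).

Record indexing_collection := IndexingCollection {
  idx : set (set T);
  exh : nat -> set T;
  idx_compact : forall A, idx A -> compact A;
  idx_bigcap : forall D : set (set T), D !=set0 -> D `<=` idx ->
    idx (\bigcap_(A in D) A);
  idx_interior : forall A, idx A -> A <> setT -> A° <> A;
  idx_bot_neq0 : (\bigcap_(A in idx) A) !=set0;
  exh_idx : forall n, idx (exh n);
  exh_incr : forall n, exh n `<=` exh n.+1;
  exh_cover : \bigcup_n exh n = setT;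
  idx_shape : forall (A : set T) (D : set (set T)),
    idx A -> finite_set D -> D !=set0 -> D `<=` idx ->
    A `<=` \bigcup_(V in D) V -> exists2 V, D V & A `<=` V }.

Variable I : indexing_collection.

Definition bot : set T := \bigcap_(A in idx I) A.

Definition fin_union (B : set T) : Prop :=
  exists D : set (set T),
    [/\ finite_set D, D !=set0, D `<=` idx I & B = \bigcup_(V in D) V].

(* An increment C = A \ B is represented by the pair (A, B) with B included
   in A.  By Shape, the pair is determined by C unless C is empty, in which
   case A = B and A is arbitrary. *)
Definition increment (A B : set T) : Prop :=
  [/\ idx I A, fin_union B & B `<=` A].

Definition extremal_repr (B : set T) (D : set (set T)) : Prop :=
  [/\ finite_set D, D `<=` idx I,
      (forall V W, D V -> D W -> V `<=` W -> V = W) &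
      \bigcup_(V in D) V = B].

(* The A_i of the extremal representation of B, which is unique by Shape. *)
Definition ext_comp (B : set T) : set (set T) :=
  [set V | exists2 D, extremal_repr B D & D V].

(* The class A_l. *)
Definition meets (B : set T) : set (set T) :=
  [set U | exists D : set (set T),
    [/\ D !=set0, D `<=` ext_comp B & U = \bigcap_(V in D) V]].

(* The class A_C, for C = A \ B.  For A = B the general formula already gives
   {A}, except when A is the whole (compact) space, where it would give the
   empty class; the convention P_set0(x; G) = \d_x G requires {A} there too. *)
Definition AC (A B : set T) : set (set T) :=
  [set U | (A = B /\ U = A) \/ [/\ A <> B, meets B U & ~ (U `<=` B°)]].

Record separability_from_above := Separability {
  subcl : nat -> set (set T);
  eps : nat -> R;
  gapp : nat -> set T -> set T;
  subcl_finite : forall n, finite_set (subcl n);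
  subcl_idx : forall n, subcl n `<=` idx I;
  subcl_incr : forall n, subcl n `<=` subcl n.+1;
  subcl_bigcap : forall n (D : set (set T)), D !=set0 -> D `<=` subcl n ->
    subcl n (\bigcap_(A in D) A);
  subcl_exh : forall n, subcl n (exh I n);
  eps_nonincr : forall n, eps n.+1 <= eps n;
  eps_cvg0 : eps n @[n --> \oo] --> 0;
  gapp_range : forall n A, idx I A -> subcl n (gapp n A) \/ gapp n A = setT;
  gapp_cap : forall A, idx I A -> A = \bigcap_n gapp n A;
  gapp_bigcap : forall n (D : set (set T)), D !=set0 -> D `<=` idx I ->
    gapp n (\bigcap_(A in D) A) = \bigcap_(A in D) gapp n A;
  (* preservation of finite unions for a map defined on idx only: its
     extension to finite unions is well defined (D' may be a singleton) *)
  gapp_bigcup : forall n (D D' : set (set T)),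
    finite_set D -> D !=set0 -> D `<=` idx I ->
    finite_set D' -> D' !=set0 -> D' `<=` idx I ->
    \bigcup_(A in D) A = \bigcup_(A in D') A ->
    \bigcup_(A in D) gapp n A = \bigcup_(A in D') gapp n A;
  gapp_interior : forall n A, idx I A -> A `<=` (gapp n A)°;
  gapp_decr : forall m n A, (m <= n)%N -> idx I A -> gapp n A `<=` gapp m A;
  gapp_dist : forall n A, idx I A -> gapp n A `<=` exh I n ->
    hausdorff_dist A (gapp n A) <= eps n }.

(* The numberings U_C^0, ..., U_C^p and the maps psi_C, chosen for every
   increment.  The last clause describes the outcome of the inductive
   construction: at the time i is reached, either it is not yet treated and
   psi sends it to some later j (as it does j itself), or it has been treated
   as the partner of an earlier i'.  The signs in the inclusion-exclusion
   formula, which only motivate the choice of j, are not constrained. *)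
Record pairing := Pairing {
  nbr : set T -> set T -> nat;
  num : set T -> set T -> nat -> set T;
  psi : set T -> set T -> set T -> set T;
  nbr_gt0 : forall A B, increment A B -> (0 < nbr A B)%N;
  num0 : forall A B, increment A B -> num A B 0%N = A;
  num_bij : forall A B, increment A B ->
    set_bij [set i | (1 <= i <= nbr A B)%N] (AC A B) (num A B);
  num1_comp : forall A B, increment A B -> ext_comp B (num A B 1%N);
  num1_closest : forall A B, increment A B -> forall V, ext_comp B V ->
    hausdorff_dist A (num A B 1%N) <= hausdorff_dist A V;
  psi0 : forall A B, increment A B -> psi A B (num A B 0%N) = num A B 1%N;
  psi1 : forall A B, increment A B -> psi A B (num A B 1%N) = num A B 1%N;
  psi_pair : forall A B, increment A B ->
    let U := num A B in
    let paired i j := [/\ U 1%N `&` U j = U 1%N `&` U i,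
                          psi A B (U i) = U j & psi A B (U j) = U j] in
    forall i, (2 <= i <= nbr A B)%N ->
      (exists2 j, (i < j <= nbr A B)%N & paired i j) \/
      (exists2 i', (2 <= i' < i)%N & paired i' i) }.

(* The pseudo-norm of C = A \ B. *)
Definition Cnorm (N : pairing) (A B : set T) : R :=
  \big[Num.max/0]_(i < (nbr N A B).+1)
    hausdorff_dist (num N A B i) (psi N A B (num N A B i)).

Definition Cclass (m : nat) (A B : set T) : Prop :=
  [/\ increment A B, (AC A B #<= `I_m)%card & A `\` B `<=` exh I m].

Record shift_family := Shift {
  theta : set T -> set T -> set T;
  theta_idx : forall U A, idx I U -> idx I A -> idx I (theta U A);
  theta_interior : forall U A, idx I U -> idx I A -> U° !=set0 ->
    A `<=` (theta U A)°;
  theta_incr : forall U V A, idx I U -> idx I V -> idx I A -> U `<=` V ->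
    theta U A `<=` theta V A;
  theta_outer : forall (U : nat -> set T) A, idx I A ->
    (forall n, idx I (U n)) -> (forall n, U n.+1 `<=` U n) ->
    theta (\bigcap_n U n) A = \bigcap_n theta (U n) A;
  theta_bot : forall A, idx I A -> theta bot A = A;
  theta_cap : forall U A A', idx I U -> idx I A -> idx I A' ->
    theta U (A `&` A') = theta U A `&` theta U A';
  theta_of_bot : forall U, idx I U -> theta U bot = U }.

Definition theta_union (th : shift_family) (U B : set T) : set T :=
  \bigcup_(V in ext_comp B) theta th U V.

End Indexing.

Notation borel E := (g_sigma_algebraType (@open E)).

(* The product space E^J, with its product sigma-field. *)
Definition cylinders (R : realType) (E : pmetricType R) (J : Type) :
    set (set (J -> E)) :=
  [set S | exists V : J, exists2 G : set (borel E),
    measurable G & S = (fun x : J -> E => x V) @^-1` G].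

Notation Epow E J := (g_sigma_algebraType (@cylinders _ E J)).

(* A map x : set T -> E stands for a consistent family of vectors; its
   restriction to J is the vector (x_V)_(V in J). *)
Definition restr (T E : Type) (J : set (set T)) (x : set T -> E) : J -> E :=
  fun V => x (val V).

Definition path_of (T E Om : Type) (X : set T -> Om -> E) (J : set (set T))
    (w : Om) : J -> E :=
  fun V => X (val V) w.
Arguments path_of {T E Om} X J w.

Definition upd (T E : Type) (x : set T -> E) (V : set T) (y : E) : set T -> E :=
  fun W => if `[< W = V >] then y else x W.

Section Transitions.
Context (R : realType) (T : metricType R) (E : pmetricType R).
Variable I : indexing_collection T.

(* The values of the kernel at pairs (A, B) that are not increments are
   irrelevant. *)
Record transition_system := TransitionSystem {
  trans : forall A B : set T, R.-pker (Epow E (AC I A B)) ~> (borel E);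
  trans_empty : forall A, idx I A ->
    forall (x : set T -> E) (G : set (borel E)), measurable G ->
    trans A A (restr x) G = \d_(x A : borel E) G;
  (* C' = (A `&` A') `\` (B `&` A') and C'' = A `\` (B `|` (A `&` A')) *)
  trans_chapman : forall A B A', increment I A B -> idx I A' ->
    forall (x : set T -> E) (G : set (borel E)), measurable G ->
    trans A B (restr x) G =
    (\int[trans (A `&` A') (B `&` A') (restr x)]_y
       trans A (B `|` (A `&` A')) (restr (upd x (A `&` A') y)) G)%E }.

Variable P : transition_system.

Definition transf (A B : set T) (f : E -> R) (x : AC I A B -> E) : R :=
  \int[trans P A B x]_y f y.

(* The pseudo-norm of the vector x_C, C = A \ B. *)
Definition vnorm (N : pairing I) (A B : set T) (x : set T -> E) : R :=
  \big[Num.max/0]_(i < (nbr N A B).+1)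
    mdist (x (num N A B i)) (x (psi N A B (num N A B i))).

Definition feller (N : pairing I) : Prop :=
  (forall f : E -> R, C0 f -> forall A B, increment I A B ->
     C0 (@transf A B f : {ptws AC I A B -> E} -> R)) /\
  (forall f : E -> R, C0 f -> forall (m : nat) (e : R), 0 < e ->
     exists2 rho : R, 0 < rho &
     forall A B A', Cclass I m A B -> idx I A' ->
       Cnorm N (A `&` A') (B `&` A') <= rho ->
     forall x : set T -> E, vnorm N (A `&` A') (B `&` A') x <= rho ->
       `|@transf A B f (restr x) -
         @transf A (B `|` (A `&` A')) f (restr x)| <= e).

Definition shift_homogeneous (th : shift_family I) : Prop :=
  forall U A B, idx I U -> increment I A B ->
  forall x y : set T -> E, (forall V, AC I A B V -> x V = y (theta th U V)) ->
  forall G : set (borel E), measurable G ->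
  trans P A B (restr x) G =
  trans P (theta th U A) (theta_union th U B) (restr y) G.

End Transitions.

(* W is a version of the conditional expectation of Z given the class G of
   events (the definition forces G to contain the preimages under W). *)
Definition is_cond_exp d (Om : measurableType d) (R : realType)
    (Pr : probability Om R) (G : set (set Om)) (Z W : Om -> \bar R) : Prop :=
  [/\ measurable_fun setT Z,
      (forall Y : set (\bar R), measurable Y -> G (W @^-1` Y)) &
      forall S, G S -> (\int[Pr]_(w in S) W w = \int[Pr]_(w in S) Z w)%E].

Section Process.
Context (R : realType) (T : metricType R) (E : pmetricType R).
Variable I : indexing_collection T.
Context d (Om : measurableType d).
Variables (Pr : probability Om R) (F : set T -> set (set Om)).

Definition filtration : Prop :=
  [/\ (forall A, idx I A -> sigma_algebra setT (F A) /\ F A `<=` measurable),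
      (forall A A', idx I A -> idx I A' -> A `<=` A' -> F A `<=` F A') &
      forall A, idx I A -> Pr.-negligible `<=` F A].

(* The extension of F to finite unions and to the whole space; it agrees with
   a filtration F on the indexing collection. *)
Definition ext_filt (F : set T -> set (set Om)) (B : set T) : set (set Om) :=
  <<s \bigcup_(A in [set A | idx I A /\ A `<=` B]) F A >>.

Definition Gstar (A B : set T) : set (set Om) :=
  <<s \bigcup_(B' in [set B' | fin_union I B' /\ B' `&` (A `\` B) = set0])
        ext_filt F B' >>.

Definition aug_filt (S : separability_from_above I) (A : set T) :
    set (set Om) :=
  \bigcap_n ext_filt F (gapp S n A).

(* Only the values X A for A in the indexing collection are relevant. *)
Variable X : set T -> Om -> E.

(* The sigma-field generated by the vector X_C, C = A \ B. *)
Definition sigma_XC (A B : set T) : set (set Om) :=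
  [set path_of X (AC I A B) @^-1` S | S in
    (measurable : set (set (Epow E (AC I A B))))].

Definition adapted : Prop :=
  forall A, idx I A -> forall G : set (borel E), measurable G ->
    F A (X A @^-1` G).

Definition C_markov : Prop :=
  adapted /\
  forall A B, increment I A B ->
  forall f : borel E -> R, measurable_fun setT f ->
    (exists M : R, forall x, `|f x| <= M) ->
  exists W1 W2 : Om -> \bar R,
    [/\ is_cond_exp Pr (Gstar A B) (fun w => (f (X A w))%:E) W1,
        is_cond_exp Pr (sigma_XC A B) (fun w => (f (X A w))%:E) W2 &
        {ae Pr, forall w, W1 w = W2 w}].

Definition has_transitions (P : transition_system E I) : Prop :=
  forall A B, increment I A B -> forall G : set (borel E), measurable G ->
    is_cond_exp Pr (sigma_XC A B)
      (fun w => (\1_G (X A w))%:E)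
      (fun w => trans P A B (path_of X (AC I A B) w) G).

Definition initial_law (nu : set (borel E) -> \bar R) : Prop :=
  forall G : set (borel E), measurable G -> Pr (X (bot I) @^-1` G) = nu G.

Definition outer_continuous : Prop :=
  forall w A, idx I A -> forall e : R, 0 < e ->
  exists2 a : R, 0 < a &
    forall U, idx I U -> A `<=` U -> hausdorff_dist A U <= a ->
      mdist (X A w) (X U w) <= e.

Definition simple_stopping_set (xi : Om -> set T) : Prop :=
  (forall w, idx I (xi w)) /\
  (forall A, idx I A -> F A [set w | A `<=` xi w]).

Definition bounded_stopping_set (xi : Om -> set T) : Prop :=
  exists2 V, idx I V & {ae Pr, forall w, xi w `<=` V}.

Definition stopped_field (S : separability_from_above I) (xi : Om -> set T) :
    set (set Om) :=
  [set H | measurable H /\ forall B, fin_union I B ->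
    ext_filt (aug_filt S) B (H `&` [set w | xi w `<=` B])].

(* Under Pr, X is C-Markov w.r.t. the complete filtration F, with transition
   system P and initial law nu: that is, Pr is P_nu. *)
Definition markov_under (P : transition_system E I)
    (nu : set (borel E) -> \bar R) : Prop :=
  [/\ measure_is_complete Pr, filtration, C_markov, has_transitions P &
      initial_law nu].

End Process.

(* Q is the law on E^A, A the indexing collection, of a C-Markov process with
   transition system P started at x, so that E_x[f(X)] is the integral of f
   with respect to Q. *)
Definition law_from (R : realType) (T : metricType R) (E : pmetricType R)
    (I : indexing_collection T) (P : transition_system E I) (x : E)
    (Q : probability (Epow E (idx I)) R) : Prop :=
  exists (d : measure_display) (Om : measurableType d) (Pr : probability Om R)
    (F : set T -> set (set Om)) (X : set T -> Om -> E),
    markov_under Pr F X P (\d_(x : borel E)) /\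
    forall S : set (Epow E (idx I)), measurable S ->
      Q S = Pr (path_of X (idx I) @^-1` S).

(* Main.v *)
From HB Require Import structures.
Require Import Defs.
From mathcomp Require Import all_boot all_order all_algebra.
From mathcomp Require Import all_classical all_reals all_analysis.
From mathcomp Require Import measurable_realfun giry ring lra finmap.
Set Implicit Arguments.
Unset Strict Implicit.
Unset Printing Implicit Defensive.
Import Order.TTheory GRing.Theory Num.Theory.
Import numFieldNormedType.Exports.
Local Open Scope classical_set_scope.
Local Open Scope ring_scope.

(** Approximate the stopping set from above by g_n(xi), which takes finitely many
values.  Since g_n preserves intersections, {U `<=` g_n(xi)} is an event of the
form {M `<=` xi}, and every event of the stopped field meets {g_n(xi) = U} in
an event of F_U.  For a deterministic U, the law of finitely many coordinates
of X \o theta_U given F_U is obtained by adding the indices one at a time along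
a class closed under intersections: each step is one application of the
C-Markov property, and homogeneity turns the kernel of the shifted increment
into that of the original one.  The first Feller condition makes the resulting
iterated integral a continuous function of the initial state whenever the
integrand is bounded and continuous, so that summing over the values U and
letting n tend to infinity, by outer-continuity, gives the identity for xi.
Monotone approximation of open sets and a pi-lambda argument extend it to all
nonnegative measurable functions. *)

(** A stopping set only controls the events where a fixed [A] lies in [xi]. Inclusion is a partial
    order, so the event that [xi] lies in [B] is not a complement of one of these and must be
    rebuilt from countably many of them; the result lies in the past of every g_k(B), which is
    exactly what the augmented filtration asks for. The margin between A and the interior of g_n(A)
    pays for the augmentation: an event of the stopped field is known only slightly outside [xi],
    but still inside U when g_n(xi) = U. The kernels act on vectors indexed by A_C, a type that
    changes with the increment. All integrands are therefore functions of full families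
    [idx I -> E], and [rho r] forgets the coordinates outside the current finite class. The first
    Feller condition tests kernels on C_0 functions of the new state alone, whereas the iterated
    integrand also depends on the past and need not vanish at infinity; unit total mass closes this
    gap. The same iterated integral gives the finite-dimensional laws under [Px x] (take U =
    [bot I]), which identifies the right-hand side and shows that it is measurable in x. *)

Lemma finite_set_maximal (T : Type) (D : set (set T)) (V : set T) :
  finite_set D -> D V ->
  exists2 U, D U & V `<=` U /\ forall W, D W -> U `<=` W -> W = U.
Proof.
move=> /finite_setP[n]; elim: n D V => [|n IHn] D V.
  by rewrite II0 card_eq0 => /eqP ->.
move=> /eq_cardSP[X DX] D'n DV.
have [VX|nVX] := pselect (V `<=` X); last first.
  have D'V : (D `\ X) V by split => // VX; apply: nVX; rewrite VX.
  have [U [DU UX] [VU Umax]] := IHn _ _ D'n D'V.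
  have [UX'|nUX] := pselect (U `<=` X).
    by exfalso; apply: nVX; exact: subset_trans VU UX'.
  exists U => //; split => // W DW UW.
  have [WX|WX] := pselect (W = X); first by exfalso; apply: nUX; rewrite -WX.
  exact: Umax.
have [[W [[DW WX] XW]]|nW] :=
    pselect (exists W, (D `\ X) W /\ X `<=` W); last first.
  exists X => //; split => // W DW XW.
  by apply: contrapT => WX; apply: nW; exists W.
have [U [DU UX] [WU Umax]] := IHn _ _ D'n (conj DW WX).
exists U => //; split; first exact: subset_trans (subset_trans VX XW) WU.
move=> W' DW' UW'; have [W'X|W'X] := pselect (W' = X); last exact: Umax.
exfalso; apply: WX; apply/seteqP; split => //.
by rewrite -W'X; exact: subset_trans WU UW'.
Qed.

(** * Nested compact sets and the Hausdorff distance *)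

Lemma nested_compact (T : topologicalType) (K : nat -> set T) (O : set T) :
  hausdorff_space T -> (forall n, compact (K n)) ->
  (forall n, K n.+1 `<=` K n) -> open O -> \bigcap_n K n `<=` O ->
  exists n, K n `<=` O.
Proof.
move=> hT cK dK oO KO.
have mK m n : (m <= n)%N -> K n `<=` K m.
  move=> /subnK <-; elim: (n - m)%N => [|k IHk]//=.
  by rewrite addSn; exact: subset_trans (dK _) IHk.
apply: contrapT => nKO.
have ex n : exists x, K n x /\ ~ O x.
  apply: contrapT => nx; apply: nKO; exists n => x Kx.
  by apply: contrapT => Ox; apply: nx; exists x.
have [u uP] := choice ex.
have uK m n : (m <= n)%N -> K m (u n).
  by move=> mn; apply: (mK _ _ mn); case: (uP n).
have uK0 : (u @ \oo) (K 0%N) by exists 0%N => // n _; exact: uK.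
have [x [K0x clx]] := cK 0%N (u @ \oo) _ uK0.
have Kx n : K n x.
  have : closed (K n) by exact: compact_closed.
  apply; move=> B nB.
  by apply: (clx (K n) B) => //; exists n => // k /= nk; exact: uK.
have [y [nOy Oy]] : ~` O `&` O !=set0.
  apply: clx; first by exists 0%N => // k _; case: (uP k).
  by apply: open_nbhs_nbhs; split => //; apply: KO.
by [].
Qed.

Lemma hausdorff_dist_le (R : realType) (T : metricType R) (A B : set T) (e : R) :
  0 <= e -> A `<=` B -> (forall y, B y -> exists2 x, A x & mdist y x <= e) ->
  hausdorff_dist A B <= e.
Proof.
move=> e0 AB BA; apply: ge_inf; first by exists 0 => z [].
split => // x Ax; exists x; [exact: AB|by rewrite mdistxx].
Qed.

(** The open [e]-balls around the points of the intersection form an open set containing it, so by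
    compactness this set already contains some [K n]. *)
Lemma hausdorff_dist_cvg (R : realType) (T : metricType R) (K : nat -> set T) (e : R) :
  (forall n, compact (K n)) -> (forall n, K n.+1 `<=` K n) -> 0 < e ->
  exists N, forall n, (N <= n)%N -> hausdorff_dist (\bigcap_n K n) (K n) <= e.
Proof.
move=> cK dK e0.
have mK m n : (m <= n)%N -> K n `<=` K m.
  move=> /subnK <-; elim: (n - m)%N => [|k IHk]//=.
  by rewrite addSn; exact: subset_trans (dK _) IHk.
pose O := \bigcup_(x in \bigcap_n K n) (ball x e)°.
have [N KNO] : exists N, K N `<=` O.
  apply: nested_compact => //; first exact: metric_hausdorff.
    by apply: bigcup_open => x _; exact: open_interior.
  by move=> x Kx; exists x => //; exact: nbhsx_ballx.
exists N => n Nn; apply: hausdorff_dist_le; first exact: ltW.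
  by move=> x; exact.
move=> y Kny; have [x Kx /interior_subset] := KNO _ (mK _ _ Nn _ Kny).
by rewrite ballEmdist /= => xy; exists x => //; rewrite metric_sym ltW.
Qed.

Lemma metric_ball_open (R : realType) (T : metricType R) (x : T) (e : R) :
  open (ball x e).
Proof.
rewrite openE => y; rewrite ballEmdist /= => xy.
apply/nbhs_ballP; exists (e - mdist x y) => /=; first by rewrite subr_gt0.
move=> z; rewrite !ballEmdist /= => yz.
by apply: le_lt_trans (metric_triangle x y z) _; rewrite -ltrBrDl.
Qed.

(** * The approximation maps g_n and their left adjoints *)

Section IndexingCollection.
Context (R : realType) (T : metricType R) (I : indexing_collection T).
Implicit Types (A B U V W : set T) (D : set (set T)).

Lemma idx_setI A B : idx I A -> idx I B -> idx I (A `&` B).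
Proof.
move=> iA iB; have -> : A `&` B = \bigcap_(V in [set A; B]) V.
  by rewrite bigcap_setU1 bigcap_set1.
by apply: idx_bigcap => [|V [->|->]]//; exists A; left.
Qed.

Lemma idx_bot : idx I (bot I).
Proof. by apply: idx_bigcap => //; exists (exh I 0%N); exact: exh_idx. Qed.

Lemma bot_sub A : idx I A -> bot I `<=` A.
Proof. by move=> iA x; apply. Qed.

Lemma fin_union_idx A : idx I A -> fin_union I A.
Proof.
move=> iA; exists [set A]; split; [exact: finite_set1|by exists A|by move=> _ ->|].
by rewrite bigcup_set1.
Qed.

Variable S : separability_from_above I.
Local Notation g := (gapp S).

Lemma gappS n A B : idx I A -> idx I B -> A `<=` B -> g n A `<=` g n B.
Proof.
move=> iA iB AB; suff -> : g n A = g n A `&` g n B by [].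
have AE : A = \bigcap_(V in [set A; B]) V.
  by rewrite bigcap_setU1 bigcap_set1 setIidl.
rewrite [in LHS]AE gapp_bigcap ?bigcap_setU1 ?bigcap_set1//; first by exists A; left.
by move=> V [->|->].
Qed.

Lemma gappI n A B : idx I A -> idx I B -> g n (A `&` B) = g n A `&` g n B.
Proof.
move=> iA iB; have -> : A `&` B = \bigcap_(V in [set A; B]) V.
  by rewrite bigcap_setU1 bigcap_set1.
rewrite gapp_bigcap ?bigcap_setU1 ?bigcap_set1//; first by exists A; left.
by move=> V [->|->].
Qed.

Lemma sub_gapp n A : idx I A -> A `<=` g n A.
Proof. by move=> iA; apply: subset_trans (gapp_interior S n iA) _; exact: interior_subset. Qed.

Definition gapp_values n := subcl S n `|` [set setT].

Lemma finite_gapp_values n : finite_set (gapp_values n).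
Proof. by rewrite finite_setU; split; [exact: subcl_finite|exact: finite_set1]. Qed.

Lemma gapp_valuesP n A : idx I A -> gapp_values n (g n A).
Proof. exact: gapp_range. Qed.

(* gapp n preserves intersections, hence has a left adjoint gapp_adj n. *)
Definition gapp_adj n U := \bigcap_(A in [set A | idx I A /\ U `<=` g n A]) A.

Lemma gapp_adj_idx n U A : idx I A -> U `<=` g n A -> idx I (gapp_adj n U).
Proof. by move=> iA UA; apply: idx_bigcap => [|V []//]; exists A. Qed.

(** The set [A] guards against an empty intersection, which would be the whole space and possibly
    not an indexing set. Given [A], preservation of intersections puts [U] inside
    [g n (gapp_adj n U)], the unit of the adjunction. *)
Lemma gapp_adjP n U A : idx I A -> U `<=` g n A ->
  forall B, idx I B -> (U `<=` g n B) <-> (gapp_adj n U `<=` B).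
Proof.
move=> iA UA B iB; split=> [UB x|adjB]; first by apply; split.
apply: subset_trans (_ : U `<=` g n (gapp_adj n U)) _; last first.
  exact: gappS (gapp_adj_idx iA UA) iB adjB.
rewrite gapp_bigcap; [|by exists A|by move=> V []].
by move=> x Ux V [_]; apply.
Qed.

(** [g n A] may be the whole space, which need not be an indexing set. For a proper [A] some [g n A]
    is proper, as these sets shrink to [A], and monotonicity keeps the later ones proper. *)
Lemma gapp_idx_near A : idx I A ->
  exists n0, forall n, (n0 <= n)%N -> idx I (g n A).
Proof.
move=> iA; have gidx n : g n A <> setT -> idx I (g n A).
  by move=> gT; have [/subcl_idx//|] := gapp_range S n iA.
have [AT|AT] := pselect (A = setT).
  exists 0%N => n _; suff -> : g n A = A by [].
  apply/seteqP; split; last exact: sub_gapp.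
  by rewrite AT.
have [n0 gn0T] : exists n0, g n0 A <> setT.
  apply: contrapT => /forallNP gT; apply: AT.
  rewrite (gapp_cap S iA) -subTset => x _ n _.
  by have /contrapT -> := gT n.
exists n0 => n n0n; apply: gidx => gnT; apply: gn0T.
by rewrite -subTset -gnT; exact: gapp_decr.
Qed.

Lemma gapp_nested A (O : set T) : idx I A -> open O -> A `<=` O ->
  exists n0, forall n, (n0 <= n)%N -> g n A `<=` O.
Proof.
move=> iA oO AO; have [m mP] := gapp_idx_near iA.
have [n nO] : exists n, g (m + n)%N A `<=` O.
  apply: nested_compact => //; first exact: metric_hausdorff.
  - by move=> n; apply: idx_compact; apply: mP; rewrite leq_addr.
  - by move=> n; apply: gapp_decr => //; rewrite addnS.
  - apply: subset_trans AO => x gx; rewrite (gapp_cap S iA) => k _.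
    apply: (@gapp_decr _ _ _ S k (m + k)%N A) => //; first exact: leq_addl.
    exact: gx.
exists (m + n)%N => k mnk; apply: subset_trans nO; exact: gapp_decr.
Qed.

(* Iterating gapp k reaches the whole space, as A is properly contained in
   gapp k A by idx_interior; maximality of U replaces the iteration. *)
Lemma sub_of_gappI k A B : idx I A -> idx I B -> A `&` g k B `<=` B -> A `<=` B.
Proof.
move=> iA iB AgB.
pose D := [set U | subcl S k U /\ A `&` U `<=` B].
have [|DgB] := gapp_range S k iB; last by move: AgB; rewrite DgB setIT.
move=> sgB; have fD : finite_set D.
  by apply: sub_finite_set (subcl_finite S k) => U [].
have [U [sU AUB] [_ Umax]] := finite_set_maximal fD (conj sgB AgB).
have iU := subcl_idx sU.
(* Applying [g k] to the inclusion of A cap U in B puts A cap [g k U] inside [g k B], where [AgB]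
   applies. So [g k U], unless it is the whole space, competes with the maximal [U]; then [U] equals
   [g k U], hence is open. *)
have AgU : A `&` g k U `<=` B.
  move=> x [Ax gUx]; apply: AgB; split => //.
  have gAU : g k (A `&` U) `<=` g k B by apply: gappS => //; exact: idx_setI.
  by apply: gAU; rewrite gappI//; split => //; exact: sub_gapp.
have UT : g k U = setT -> A `<=` B by move=> gUT; move: AgU; rewrite gUT setIT.
have [sgU|//] := gapp_range S k iU.
have gUU := Umax _ (conj sgU AgU) (sub_gapp k iU).
have [UT'|UT'] := pselect (U = setT); first by move: AUB; rewrite UT' setIT.
exfalso; apply: (idx_interior iU UT'); apply/seteqP; split; first exact: interior_subset.
by have := gapp_interior S k iU; rewrite gUU.
Qed.

End IndexingCollection.

(** * Events determined by a simple stopping set *)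

Section StoppingSet.
Context (R : realType) (T : metricType R) (I : indexing_collection T).
Variable S : separability_from_above I.
Local Notation g := (gapp S).
Context d (Om : measurableType d) (Pr : probability Om R).
Variable F : set T -> set (set Om).
Hypothesis filtF : filtration I Pr F.

Let FS A : idx I A -> sigma_algebra setT (F A).
Proof. by case: filtF => + _ _ => /[apply] -[]. Qed.

Lemma sub_ext_filt A B : idx I A -> A `<=` B -> F A `<=` ext_filt I F B.
Proof. by move=> iA AB H FH; apply: sub_sigma_algebra; exists A. Qed.

Lemma ext_filtS A B : A `<=` B -> ext_filt I F A `<=` ext_filt I F B.
Proof.
move=> AB; apply: sub_sigma_algebra2 => H [U [iU UA] FH].
by exists U => //; split => //; exact: subset_trans UA AB.
Qed.

Lemma ext_filt_idx A : idx I A -> ext_filt I F A = F A.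
Proof.
move=> iA; apply/seteqP; split; last exact: sub_ext_filt.
apply: smallest_sub; first exact: FS.
by move=> H [U [iU UA] FH]; have [_ FF _] := filtF; exact: (FF U).
Qed.

Lemma ext_filt_measurable B : ext_filt I F B `<=` measurable.
Proof.
apply: smallest_sub; first exact: sigma_algebra_measurable.
by move=> H [U [iU _] FH]; have [/(_ _ iU)[_ +] _ _] := filtF; exact.
Qed.

Variable xi : Om -> set T.
Hypothesis stop_xi : simple_stopping_set I F xi.

Let ixi w : idx I (xi w). Proof. by case: stop_xi. Qed.

(** If [xi w] is not inside [B], then by [sub_of_gappI] neither is A = [xi w] cap [g k B], and some
    [g n] separates A from [B]. The adjoint of [g n A] is then a set inside [xi w], not inside [B],
    chosen among finitely many for each n. Cutting by [g k B] keeps this witness, and the event that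
    it lies in [xi], in the past of [g k B]. *)
Lemma stopping_sub B k : idx I B -> ext_filt I F (g k B) [set w | xi w `<=` B].
Proof.
move=> iB.
pose D n := gapp_values S n `&` [set U | [/\ idx I (gapp_adj S n U),
  gapp_adj S n U `<=` g k B & ~ (gapp_adj S n U `<=` B)]].
have -> : [set w | xi w `<=` B] =
    ~` (\bigcup_n \bigcup_(U in D n) [set w | gapp_adj S n U `<=` xi w]).
  apply/seteqP; split=> [w xiB [n _ [U [_ [_ _ UB]] Uxi]]|w /= nU].
    by apply: UB; exact: subset_trans Uxi xiB.
  apply: (sub_of_gappI (S := S) (k := k)) => //.
  apply: contrapT => AB; apply: nU.
  have iA : idx I (xi w `&` g k B).
    have [/subcl_idx igB|->] := gapp_range S k iB; last by rewrite setIT.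
    exact: idx_setI.
  set A := xi w `&` g k B in AB iA.
  have [n gAB] : exists n, ~ (g n A `<=` g n B).
    apply: contrapT => /forallNP gAB; apply: AB => x Ax.
    rewrite (gapp_cap S iB) => n _.
    by have /contrapT := gAB n; apply; exact: sub_gapp.
  have adjA : gapp_adj S n (g n A) `<=` A by apply: (gapp_adjP iA _ _).1.
  have iadj := gapp_adj_idx iA (@subset_refl _ (g n A)).
  exists n => //; exists (g n A) => /=.
    split; [exact: gapp_valuesP|split => //].
      by apply: subset_trans adjA _; exact: subIsetr.
    by move=> adjB; apply: gAB; apply: (gapp_adjP iA _ iB).2.
  by apply: subset_trans adjA _; exact: subIsetl.
apply: (@measurableC _ (g_sigma_algebraType _)).
apply: (@bigcup_measurable _ (g_sigma_algebraType _)) => n _.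
apply: (@fin_bigcup_measurable _ (g_sigma_algebraType _)).
  by apply: finite_setIl; exact: finite_gapp_values.
move=> U [_ [iU UB _]]; apply: (sub_ext_filt iU UB).
by case: stop_xi => _; apply.
Qed.

(** A point of the event supplies the set that the adjunction needs; the condition on [g n (xi w)]
    then becomes the inclusion of one fixed set in [xi w], an event of the filtration. *)
Lemma stopping_gapp_ge n U W k : idx I W ->
  ext_filt I F (g k W) [set w | U `<=` g n (xi w) /\ xi w `<=` W].
Proof.
move=> iW.
have [[w0 [Uxi xiW]]|nU] := pselect (exists w, U `<=` g n (xi w) /\ xi w `<=` W); last first.
  rewrite (_ : mkset _ = set0); first exact: (@measurable0 _ (g_sigma_algebraType _)).
  by rewrite -subset0 => w Uw; apply: nU; exists w.
rewrite (_ : mkset _ = [set w | gapp_adj S n U `<=` xi w] `&` [set w | xi w `<=` W]).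
  apply: (@measurableI _ (g_sigma_algebraType _)); last exact: stopping_sub.
  apply: (sub_ext_filt (gapp_adj_idx (ixi w0) Uxi)); last first.
    case: stop_xi => _; apply; exact: gapp_adj_idx Uxi.
  apply: (subset_trans (B := xi w0)); first by apply: (gapp_adjP (ixi w0) _ _).1.
  by apply: subset_trans xiW _; exact: sub_gapp.
by apply/seteqP; split=> w /= [Uw xw]; split => //; apply/(gapp_adjP (ixi w0) Uxi (ixi w)).
Qed.

(** Since [g n] has finitely many values, equality with [U] reduces to inclusions: the value
    contains [U] and contains no possible value that is not a subset of [U]. *)
Lemma stopping_gapp_eq n U W k : idx I W ->
  ext_filt I F (g k W) [set w | g n (xi w) = U /\ xi w `<=` W].
Proof.
move=> iW.
pose D := gapp_values S n `&` [set V | ~ (V `<=` U)].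
rewrite (_ : mkset _ = [set w | U `<=` g n (xi w) /\ xi w `<=` W] `\`
    \bigcup_(V in D) [set w | V `<=` g n (xi w) /\ xi w `<=` W]).
  apply: (@measurableD _ (g_sigma_algebraType _)); first exact: stopping_gapp_ge.
  apply: (@fin_bigcup_measurable _ (g_sigma_algebraType _)).
    by apply: finite_setIl; exact: finite_gapp_values.
  by move=> V _; exact: stopping_gapp_ge.
apply/seteqP; split=> [w [gU xiW]|w [[Uw xiW] nV]].
  by split; [split; rewrite // gU|move=> -[V [_ nVU] [+ _]]; rewrite gU].
split => //; apply/seteqP; split => //; apply: contrapT => gU; apply: nV.
exists (g n (xi w)); last by split => //; exact: subset_refl.
by split => //; exact: gapp_valuesP.
Qed.

Lemma measurable_gapp_eq n U : measurable [set w | g n (xi w) = U].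
Proof.
have mge V : measurable [set w | V `<=` g n (xi w)].
  have [[w0 Vxi]|nV] := pselect (exists w, V `<=` g n (xi w)); last first.
    rewrite (_ : mkset _ = set0); first exact: measurable0.
    by rewrite -subset0 => w Vw; apply: nV; exists w.
  have iV := gapp_adj_idx (ixi w0) Vxi.
  rewrite (_ : mkset _ = [set w | gapp_adj S n V `<=` xi w]).
    have [/(_ _ iV)[_ +] _ _] := filtF; apply.
    by case: stop_xi => _; exact.
  by apply/seteqP; split=> w /=; apply (gapp_adjP (ixi w0) Vxi (ixi w)).
pose D := gapp_values S n `&` [set V | ~ (V `<=` U)].
rewrite (_ : mkset _ = [set w | U `<=` g n (xi w)] `\`
    \bigcup_(V in D) [set w | V `<=` g n (xi w)]).
  apply: measurableD => //; apply: fin_bigcup_measurable => //.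
  by apply: finite_setIl; exact: finite_gapp_values.
apply/seteqP; split=> [w gU|w [Uw nV]].
  by split; [rewrite /= gU|move=> -[V [_ nVU]]; rewrite /= gU].
apply/seteqP; split => //; apply: contrapT => gU; apply: nV.
exists (g n (xi w)); last exact: subset_refl.
by split => //; exact: gapp_valuesP.
Qed.

Local Notation stopped := (stopped_field F S xi).

(** By Shape, [xi w] lies in a finite union of indexing sets only if it lies in one of them, so
    single sets suffice as tests. *)
Lemma stopped_fieldP H : stopped H <-> measurable H /\
  forall B, idx I B -> forall k, ext_filt I F (g k B) (H `&` [set w | xi w `<=` B]).
Proof.
split=> -[mH HP]; split => // B.
  move=> iB k; have := HP _ (fin_union_idx iB).
  apply: smallest_sub; first exact: smallest_sigma_algebra.
  move=> K [A [iA AB] FK]; have := FK k Logic.I.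
  by apply: ext_filtS; exact: gappS.
move=> [D [fD D0 Di BE]].
have -> : H `&` [set w | xi w `<=` B] =
    \bigcup_(V in D) (H `&` [set w | xi w `<=` V]).
  apply/seteqP; split=> [w [Hw /=]|w [V DV [Hw /= xiV]]].
    rewrite BE => /(idx_shape (ixi w) fD D0 Di)[V DV xiV].
    by exists V.
  by split => //=; rewrite BE => x /xiV Vx; exists V.
apply: (@fin_bigcup_measurable _ (g_sigma_algebraType _)) => // V DV.
apply: sub_sigma_algebra; exists V.
  by split; [exact: Di|rewrite BE => x Vx; exists V].
by move=> k _; apply: HP; exact: Di.
Qed.

Lemma sigma_algebra_stopped : sigma_algebra setT stopped.
Proof.
split.
- apply/stopped_fieldP; split => // B iB k; rewrite set0I.
  exact: (@measurable0 _ (g_sigma_algebraType _)).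
- move=> H /stopped_fieldP[mH HP]; apply/stopped_fieldP; split.
    by rewrite setTD; exact: measurableC.
  move=> B iB k; rewrite setTD.
  rewrite (_ : _ `&` _ = [set w | xi w `<=` B] `\` (H `&` [set w | xi w `<=` B])).
    apply: (@measurableD _ (g_sigma_algebraType _)); last exact: HP.
    exact: stopping_sub.
  by rewrite setDIr setDv setU0 setDE setIC.
- move=> H HP; apply/stopped_fieldP; split.
    by apply: bigcup_measurable => n _; case/stopped_fieldP: (HP n).
  move=> B iB k; rewrite setI_bigcupl.
  apply: (@bigcup_measurable _ (g_sigma_algebraType _)) => n _.
  by case/stopped_fieldP: (HP n) => _; apply.
Qed.

Lemma stopped_gapp_eq n U : stopped [set w | g n (xi w) = U].
Proof.
apply/stopped_fieldP; split; first exact: measurable_gapp_eq.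
by move=> B iB k; exact: stopping_gapp_eq.
Qed.

Lemma stoppedI H K : stopped H -> stopped K -> stopped (H `&` K).
Proof.
rewrite -(sigma_algebra_id sigma_algebra_stopped).
exact: (@measurableI _ (g_sigma_algebraType _)).
Qed.

(** Here the augmentation is removed. On the event, [xi w] lies in the interior of [U], so by
    compactness W = [g j (xi w)], and then [g k W], lie in [U] for suitable j and k. As W ranges
    over finitely many sets for each j, the event is a countable union of pieces where [xi] lies in
    W, each in the past of [g k W] and hence in [F U]. *)
Lemma stopped_gapp_eq_filt H n U : idx I U -> stopped H ->
  F U (H `&` [set w | g n (xi w) = U]).
Proof.
move=> iU sH; rewrite -ext_filt_idx//.
have /stopped_fieldP[_ HP] := stoppedI sH (stopped_gapp_eq n U).
pose K := H `&` [set w | g n (xi w) = U].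
pose D l k := gapp_values S l `&` [set W | idx I W /\ g k W `<=` U].
rewrite -/K (_ : K = \bigcup_l \bigcup_k \bigcup_(W in D l k)
   (K `&` [set w | xi w `<=` W])).
  apply: (@bigcup_measurable _ (g_sigma_algebraType _)) => l _.
  apply: (@bigcup_measurable _ (g_sigma_algebraType _)) => k _.
  apply: (@fin_bigcup_measurable _ (g_sigma_algebraType _)).
    by apply: finite_setIl; exact: finite_gapp_values.
  by move=> W [_ [iW gW]]; apply: (ext_filtS gW); exact: HP.
apply/seteqP; split=> [w Kw|w [l _ [k _ [W _ []//]]]].
have [_ gU] := Kw; have oU : xi w `<=` U° by rewrite -gU; exact: gapp_interior.
have [l lP] := gapp_nested S (ixi w) (open_interior U) oU.
have [m mP] := gapp_idx_near S (ixi w).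
pose j := maxn l m; have jU := lP j (leq_maxl _ _).
have ij := mP j (leq_maxr _ _).
have [k kP] := gapp_nested S ij (open_interior U) jU.
exists j => //; exists k => //; exists (g j (xi w)).
  split; first exact: gapp_valuesP.
  split => //; apply: subset_trans (kP k (leqnn k)) _; exact: interior_subset.
by split => //=; exact: sub_gapp.
Qed.

End StoppingSet.

(** * Measurability of the stopped process *)

(** The limit is in [O] exactly when, for some m, the approximants are eventually in [C m], the
    closed set of points whose ball of radius 1/(m+1) stays in [O]. *)
Lemma measurable_borel_lim (R : realType) (E : pmetricType R) d
    (Om : measurableType d) (Y_ : nat -> Om -> borel E) (Y : Om -> borel E) :
  (forall n, measurable_fun setT (Y_ n)) ->
  (forall w (e : R), 0 < e -> exists N, forall n, (N <= n)%N ->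
     mdist (Y w : E) (Y_ n w) <= e) ->
  measurable_fun setT Y.
Proof.
move=> mY_ cY; apply: (@measurability _ _ _ (borel E) setT Y (@open E)) => //.
move=> _ [ O oO <-]; rewrite setTI.
pose C m : set (borel E) := [set y : E | forall z, mdist y z < m.+1%:R^-1 -> O z].
have mC m : measurable (C m).
  have -> : C m = ~` (\bigcup_(z in ~` O) ball (z : E) m.+1%:R^-1).
    apply/seteqP; split=> [y Cy [z nOz]|y nB z yz].
      by rewrite ballEmdist /= metric_sym => /Cy.
    apply: contrapT => nOz; apply: nB; exists z => //.
    by rewrite ballEmdist /= metric_sym.
  apply: measurableC; apply: sub_sigma_algebra.
  by apply: bigcup_open => z _; exact: metric_ball_open.
have -> : Y @^-1` O = \bigcup_m \bigcup_N \bigcap_n (Y_ (N + n)%N @^-1` C m).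
  apply/seteqP; split=> [w /= OYw|w [m _ [N _ Cw]]].
    have [e /= e0 eO] := (nbhs_ballP _ _).1 (open_nbhs_nbhs (conj oO OYw)).
    have e20 : 0 < e / 2 by rewrite divr_gt0.
    have [m _ me] := near_infty_natSinv_lt (PosNum e20).
    have [N NP] := cY w _ e20.
    exists m => //; exists N => // n _ z /= yz; apply: eO.
    rewrite ballEmdist /=; apply: le_lt_trans (metric_triangle _ (Y_ (N + n)%N w) _) _.
    rewrite [ltRHS]splitr; apply: ler_ltD; first by apply: NP; exact: leq_addr.
    by apply: lt_trans yz _; exact: me (leqnn m).
  (* [C m] asks for a strict inequality and convergence only gives a weak one; 1/(m+2) leaves the
     margin. *)
  have [M MP] := cY w (m.+2%:R^-1) ltac:(by rewrite invr_gt0).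
  apply: (Cw M Logic.I); rewrite metric_sym.
  apply: le_lt_trans (MP _ (leq_addl _ _)) _.
  by rewrite ltf_pV2 ?posrE// ltr_nat.
apply: bigcup_measurable => m _; apply: bigcup_measurable => N _.
apply: bigcapT_measurable => n.
by rewrite -[_ @^-1` _]setTI; exact: mY_.
Qed.

(** Each [Z U] is tested only on the piece where it is used. This matters for small sigma-fields,
    for which [Z U] need not be measurable as a whole. *)
Lemma measurable_fun_glue d d' (Om : measurableType d) (E : measurableType d')
    (C : Type) (c : Om -> C) (D : set C) (P : set Om) (Z : C -> Om -> E)
    (Z0 : Om -> E) : finite_set D ->
  (forall U, D U -> measurable ([set w | c w = U] `&` P)) ->
  (forall U B, D U -> measurable B ->
     measurable ([set w | c w = U] `&` P `&` Z U @^-1` B)) ->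
  measurable_fun setT Z0 ->
  measurable_fun setT
    (fun w => if `[< D (c w) /\ P w >] then Z (c w) w else Z0 w).
Proof.
move=> fD mc mcZ mZ0 _ B mB; rewrite setTI.
rewrite (_ : _ @^-1` B =
  (\bigcup_(U in D) ([set w | c w = U] `&` P `&` Z U @^-1` B)) `|`
  (~` (\bigcup_(U in D) ([set w | c w = U] `&` P)) `&` Z0 @^-1` B)).
  apply: measurableU; first by apply: fin_bigcup_measurable => // U DU; exact: mcZ.
  apply: measurableI; last by rewrite -[_ @^-1` _]setTI; exact: mZ0.
  by apply: measurableC; exact: fin_bigcup_measurable.
apply/seteqP; split=> [w|w [[U DU [[/= cw Pw] Zw]]|[nU Zw]]] /=.
- case: asboolP => [[Dw Pw] Zw|nDP Zw]; first by left; exists (c w).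
  by right; split => // -[U DU [/= cw Pw]]; apply: nDP; rewrite cw.
- by rewrite cw; case: asboolP => // -[].
- case: asboolP => // -[Dw Pw]; exfalso; apply: nU; by exists (c w).
Qed.

Section Shift.
Context (R : realType) (T : metricType R) (I : indexing_collection T).
Variables (S : separability_from_above I) (th : shift_family I).
Local Notation g := (gapp S).

Lemma theta_subr U A B : idx I U -> idx I A -> idx I B -> A `<=` B ->
  theta th U A `<=` theta th U B.
Proof.
move=> iU iA iB AB; suff -> : theta th U A = theta th U A `&` theta th U B by [].
by rewrite -theta_cap// setIidl.
Qed.

(** Monotone outer-continuity of the shift in its index gives decreasing compact sets with the right
    intersection; compactness turns this into Hausdorff convergence, the form required by
    outer-continuity of [X]. Indices start at [m] so that all the sets are indexing sets. *)
Lemma outer_continuous_gapp (E : pmetricType R) d (Om : measurableType d) (X : set T -> Om -> E)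
    (w : Om) (A V : set T) (e : R) :
  outer_continuous I X -> idx I A -> idx I V -> 0 < e ->
  exists N, forall n, (N <= n)%N ->
    idx I (g n A) /\ mdist (X (theta th A V) w) (X (theta th (g n A) V) w) <= e.
Proof.
move=> oX iA iV e0.
have [a a0 aP] := oX w _ (theta_idx th iA iV) e e0.
have [m mP] := gapp_idx_near S iA.
have imn n : idx I (g (m + n)%N A) by apply: mP; exact: leq_addr.
have dec n : g (m + n.+1)%N A `<=` g (m + n)%N A.
  by apply: gapp_decr => //; rewrite addnS.
have [N NP] := @hausdorff_dist_cvg _ _ (fun n => theta th (g (m + n)%N A) V) a
  (fun n => idx_compact (theta_idx th (imn n) iV))
  (fun n => @theta_incr _ _ _ th _ _ _ (imn n.+1) (imn n) iV (dec n)) a0.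
exists (m + N)%N => n mNn; have mn : (m <= n)%N by exact: leq_trans (leq_addr _ _) mNn.
split; first exact: mP.
have iU : idx I (g n A) by exact: mP.
apply: aP; first exact: theta_idx.
  by apply: theta_incr => //; exact: sub_gapp.
have := NP (n - m)%N; rewrite subnKC// leq_subRL// => /(_ mNn).
rewrite -(theta_outer th iV imn dec).
suff <- : A = \bigcap_n g (m + n)%N A by [].
apply/seteqP; split=> [x Ax k _|x gx]; first exact: sub_gapp.
rewrite (gapp_cap S iA) => k _; apply: (@gapp_decr _ _ _ S k (m + k)%N A) => //.
  exact: leq_addl.
exact: gx.
Qed.

End Shift.

Section StoppedProcess.
Context (R : realType) (T : metricType R) (E : pmetricType R).
Context (I : indexing_collection T).
Variables (S : separability_from_above I) (th : shift_family I).
Local Notation g := (gapp S).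
Context d (Om : measurableType d) (Pr : probability Om R).
Variable F : set T -> set (set Om).
Hypothesis filtF : filtration I Pr F.
Variable X : set T -> Om -> E.
Hypotheses (adX : adapted I F X) (oX : outer_continuous I X).
Variable xi : Om -> set T.
Hypothesis stop_xi : simple_stopping_set I F xi.

Let ixi w : idx I (xi w). Proof. by case: stop_xi. Qed.
Let F_measurable A : idx I A -> F A `<=` measurable.
Proof. by move=> iA; have [/(_ _ iA)[]] := filtF. Qed.

Lemma adapted_measurable A : idx I A -> measurable_fun setT (X A : Om -> borel E).
Proof.
move=> iA _ B mB; rewrite setTI; apply: (F_measurable iA); exact: adX.
Qed.

Let finD n : finite_set (gapp_values S n `&` idx I).
Proof. by apply: finite_setIl; exact: finite_gapp_values. Qed.

Lemma measurable_theta_stopping V : idx I V ->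
  measurable_fun setT ((fun w => X (theta th (xi w) V) w) : Om -> borel E).
Proof.
move=> iV; pose c n w := g n (xi w).
(* The default [X V w] covers the case where [g n (xi w)] is the whole space and not an indexing
   set; for fixed [w] it disappears for large n. *)
apply: (@measurable_borel_lim _ _ _ _ (fun n w =>
  if `[< (gapp_values S n `&` idx I) (c n w) /\ setT w >]
  then X (theta th (c n w) V) w else X V w)) => [n|w e e0].
  apply: (@measurable_fun_glue _ _ Om (borel E) _ (c n)
    (gapp_values S n `&` idx I) setT (fun U w => X (theta th U V) w) (X V)) => //.
  - by move=> U _; rewrite setIT; exact: (measurable_gapp_eq S filtF stop_xi).
  - move=> U B [_ iU] mB; rewrite setIT; apply: measurableI.
      exact: (measurable_gapp_eq S filtF stop_xi).
    by rewrite -[_ @^-1` _]setTI; apply: adapted_measurable => //; exact: theta_idx.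
  - exact: adapted_measurable.
have [N NP] := outer_continuous_gapp S th w oX (ixi w) iV e0.
exists N => n /NP[ig d_le]; rewrite asboolT//; split => //; split => //.
exact: gapp_valuesP.
Qed.

Lemma stopped_measurable (B : set (borel E)) : measurable B ->
  stopped_field F S xi [set w | B (X (xi w) w)].
Proof.
move=> mB; apply/(stopped_fieldP S stop_xi); split.
  have := measurable_theta_stopping (idx_bot I) measurableT mB; rewrite setTI.
  by congr measurable; apply/seteqP; split=> w /=; rewrite theta_of_bot.
move=> A iA k.
pose G := \bigcup_(U in [set U | idx I U /\ U `<=` g k A]) F U.
(* The index [k + n] keeps the approximation of [xi] inside [g k A] whenever [xi] is inside [A], so
   only values of [X] known in the past of [g k A] occur. Off that event the constant choice [bot I]
   is harmless. *)
pose Z n w := if `[< (gapp_values S (k + n)%N `&` idx I) (g (k + n)%N (xi w)) /\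
    [set w | xi w `<=` A] w >] then X (g (k + n)%N (xi w)) w else X (bot I) w.
pose Y w := if `[< xi w `<=` A >] then X (xi w) w else X (bot I) w.
have FG U : idx I U -> U `<=` g k A -> F U `<=` <<s G>>.
  by move=> iU UA; exact: sub_ext_filt.
have botG : measurable_fun setT (X (bot I) : g_sigma_algebraType G -> borel E).
  move=> _ C mC; rewrite setTI; apply: (FG _ (idx_bot I)).
    by apply: (subset_trans (bot_sub iA)); exact: sub_gapp.
  by apply: adX => //; exact: idx_bot.
have mY : measurable_fun setT (Y : g_sigma_algebraType G -> borel E).
  apply: (@measurable_borel_lim _ _ _ (g_sigma_algebraType G) Z) => [n|w e e0].
    apply: (@measurable_fun_glue _ _ (g_sigma_algebraType G) (borel E) _ _ _ _ X) => //.
      by move=> U _; exact: stopping_gapp_eq.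
    move=> U C [_ iU] mC.
    have [[w0 [/= gU xiA]]|nU] :=
      pselect (exists w, g (k + n)%N (xi w) = U /\ xi w `<=` A); last first.
      rewrite (_ : _ `&` _ = set0); first exact: (@measurable0 _ (g_sigma_algebraType G)).
      by rewrite -subset0 => w [[/= Uw Aw] _]; apply: nU; exists w.
    apply: (@measurableI _ (g_sigma_algebraType G)); first exact: stopping_gapp_eq.
    apply: (FG U) => //; last exact: adX.
    rewrite -gU; apply: (subset_trans (B := g (k + n)%N A)).
      exact: gappS.
    by apply: gapp_decr => //; exact: leq_addr.
  have [xiA|nxiA] := pselect (xi w `<=` A); last first.
    exists 0%N => n _; rewrite /Y /Z asboolF// asboolF; last by case.
    by rewrite mdistxx ltW.
  have [N NP] := outer_continuous_gapp S th w oX (ixi w) (idx_bot I) e0.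
  exists N => n Nn; have /NP[ig] : (N <= k + n)%N by exact: leq_trans Nn (leq_addl _ _).
  rewrite !theta_of_bot// /Y /Z asboolT// asboolT//; split => //.
  by split => //; exact: gapp_valuesP.
rewrite (_ : _ `&` _ = Y @^-1` B `&` [set w | xi w `<=` A]).
  apply: (@measurableI _ (g_sigma_algebraType G)); last exact: stopping_sub.
  by rewrite -[_ @^-1` _]setTI; exact: mY.
by apply/seteqP; split=> w [/= + xiA]; rewrite /Y asboolT.
Qed.

End StoppedProcess.

(** * Comparison of mixtures of measures on a pi-system *)

Section Mixture.
Local Open Scope ereal_scope.
Context d d' (Om : measurableType d) (Z : measurableType d') (R : realType).
Variables (mu : giry Om R) (G : set (set Z)).
Hypotheses (mG : @measurable _ Z = <<s G>>) (GI : setI_closed G) (GT : G setT).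

(** Both sides integrate [h] against a barycentre, the monadic bind of [mu] with the kernel, and the
    two barycentres agree on the pi-system [G]. *)
Lemma giry_mixture_eq (k1 k2 : Om -> giry Z R) (h : Z -> \bar R) :
  (forall B, measurable B -> measurable_fun setT (k1 ^~ B)) ->
  (forall B, measurable B -> measurable_fun setT (k2 ^~ B)) ->
  (forall B, G B -> \int[mu]_w k1 w B = \int[mu]_w k2 w B) ->
  measurable_fun setT h -> (forall z, 0 <= h z) ->
  \int[mu]_w \int[k1 w]_z h z = \int[mu]_w \int[k2 w]_z h z.
Proof.
move=> mk1 mk2 k12 mh h0.
have m1 := measurable_giry_codensity measurableT mk1.
have m2 := measurable_giry_codensity measurableT mk2.
rewrite -[LHS](giry_int_bind mu m1 mh h0) -[RHS](giry_int_bind mu m2 mh h0).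
have bindE k (mk : measurable_fun setT k) B : measurable B ->
    giry_bind mu mk B = \int[mu]_w (k w : giry Z R) B.
  move=> mB; rewrite /giry_bind /=; rewrite -[LHS]/(giry_int (giry_map mk mu) (fun m => giry_ev m B)).
  by rewrite giry_int_map//; exact: measurable_giry_ev.
apply: eq_measure_integral => B mB _; apply: (measure_unique G (fun=> setT)) => //.
- by rewrite bigcup_const.
- move=> C GC; have mC : measurable C by rewrite mG; exact: sub_sigma_algebra.
  by rewrite -[LHS]/(giry_bind mu m1 C) -[RHS]/(giry_bind mu m2 C) !bindE// k12.
- by move=> _; apply: (@le_lt_trans _ _ 1%E); [exact: sprobability_setT|rewrite ltry].
Qed.

(** This is the tool for checking that [k] is the conditional law of [Y]: the kernel [k] is compared
    with the Dirac kernel at [Y w]. *)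
Lemma integral_mixture (D : set Om) (Y : Om -> Z) (k : Om -> giry Z R)
    (h : Z -> \bar R) :
  measurable D -> measurable_fun setT Y ->
  (forall B, measurable B -> measurable_fun setT (k ^~ B)) ->
  (forall B, G B -> mu (D `&` Y @^-1` B) = \int[mu]_(w in D) k w B) ->
  measurable_fun setT h -> (forall z, 0 <= h z) ->
  \int[mu]_(w in D) h (Y w) = \int[mu]_(w in D) \int[k w]_z h z.
Proof.
move=> mD mY mk kB mh h0.
(* Both kernels are replaced by the zero measure off [D]; the Giry space contains sub-probabilities,
   so this remains a kernel. *)
pose restrict (l : Om -> giry Z R) w : giry Z R := if w \in D then l w else mzero.
have restrict_meas (l : Om -> giry Z R) : (forall B, measurable B -> measurable_fun setT (l ^~ B)) ->
    forall B, measurable B -> measurable_fun setT ((restrict l) ^~ B).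
  move=> ml B mB; rewrite (_ : (restrict l) ^~ B = (l ^~ B) \_ D).
    by apply/(measurable_restrictT _ mD); apply: measurable_funTS; exact: ml.
  by apply/funext => w; rewrite /restrict patchE; case: ifP.
have restrict_int (l : Om -> giry Z R) (f : Z -> \bar R) : \int[mu]_w \int[restrict l w]_z f z =
    \int[mu]_(w in D) \int[l w]_z f z.
  rewrite [RHS]integral_mkcond; apply: eq_integral => w _.
  by rewrite /restrict patchE; case: ifP => // _; rewrite integral_measure_zero.
have dirac_meas B : measurable B -> measurable_fun setT (fun w => (\d_(Y w) : giry Z R) B).
  by move=> mB; exact: (measurableT_comp (measurable_fun_dirac mB) mY).
transitivity (\int[mu]_(w in D) \int[\d_(Y w) : giry Z R]_z h z).
  by apply: eq_integral => w _; rewrite integral_dirac// diracT mul1e.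
rewrite -restrict_int -[RHS]restrict_int; apply: giry_mixture_eq => //.
- exact: restrict_meas.
- exact: restrict_meas.
move=> B GB; have mB : measurable B by rewrite mG; exact: sub_sigma_algebra.
have restrict_ev (l : Om -> giry Z R) : \int[mu]_w restrict l w B = \int[mu]_(w in D) l w B.
  rewrite [RHS]integral_mkcond; apply: eq_integral => w _.
  by rewrite /restrict patchE; case: ifP.
rewrite !restrict_ev -kB//.
have mYB : measurable (Y @^-1` B) by rewrite -[_ @^-1` _]setTI; exact: mY.
by rewrite setIC -integral_indic.
Qed.

End Mixture.

(** * Bump functions and weak continuity of kernels *)

Section BumpFunctions.
Context (R : realType) (E : pmetricType R).

Lemma continuous_borel_measurable (f : E -> R) :
  continuous f -> measurable_fun setT (f : borel E -> R).
Proof.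
move=> cf; apply: (measurability _ (RGenOInfty.measurableE R)).
move=> _ [_ [x ->] <-]; rewrite setTI; apply: sub_sigma_algebra.
apply: open_comp => [y _|]; first exact: cf.
by rewrite set_itvE; exact: open_gt.
Qed.

Lemma mdist_continuous (a : E) : continuous (fun x : E => mdist a x : R).
Proof.
move=> x; apply/cvgrPdist_lt => e e0; near=> y.
have xy : mdist x y < e.
  by near: y; apply/nbhs_ballP; exists e => //= y; rewrite ballEmdist.
have := metric_triangle a x y; have := metric_triangle a y x.
by rewrite (metric_sym y x) ltr_norml => ? ?; apply/andP; split; lra.
Unshelve. all: end_near. Qed.

Hypotheses (lcE : locally_compact [set: E]) (sepE : separable E).

(** The building blocks are tents of radius 1/(k+1) at the points of a dense sequence, kept when
    their ball lies both in [O] and in a compact set. With [O] the whole space this yields a compact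
    exhaustion; for general [O] it approximates the indicator. *)
Lemma open_bumps (O : set E) : open O -> exists phi : nat -> E -> R,
  [/\ forall n, continuous (phi n),
      forall n, exists2 K, compact K & forall x, ~ K x -> phi n x = 0,
      forall n x, 0 <= phi n x <= 1 &
      forall x, exists N, forall n, (N <= n)%N -> phi n x = \1_O x].
Proof.
move=> oO; have [D [cD dD]] := sepE.
have [e De] : exists e : nat -> E, D `<=` range e.
  have [->|[e]] := pfcard_geP cD; first by exists (fun=> point).
  by exists e => y /(@surj _ _ _ _ e)[n _ <-]; exists n.
pose r k : R := k.+1%:R^-1.
have r_gt0 k : 0 < r k by rewrite invr_gt0.
pose good j k := ball (e j) (r k) `<=` O /\
  exists2 K, compact K & ball (e j) (r k) `<=` K.
pose b (i : nat) (x : E) : R := if choice.unpickle i is Some (j, k) then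
  if `[< good j k >] then Num.max 0 (r k - mdist (e j) x) else 0 else 0.
have b_ge0 i x : 0 <= b i x.
  by rewrite /b; case: choice.unpickle => // -[j k]; case: asboolP => // _; rewrite le_max lexx.
have b_cont i : continuous (b i).
  rewrite /b; case: choice.unpickle => [[j k]|]; last exact: cst_continuous.
  case: asboolP => _; last exact: cst_continuous.
  move=> x; apply: (@continuous_max _ _ (fun=> 0) (fun x => r k - mdist (e j) x)).
    exact: cvg_cst.
  by apply: cvgB; [exact: cvg_cst|exact: mdist_continuous].
have b_supp i x : 0 < b i x -> O x.
  rewrite /b; case: choice.unpickle => [[j k]|]; last by rewrite ltxx.
  case: asboolP => [[gO _]|_]; last by rewrite ltxx.
  by rewrite lt_max ltxx /= subr_gt0 => jx; apply: gO; rewrite ballEmdist.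
have b_cpt i : exists2 K, compact K & forall x, ~ K x -> b i x = 0.
  rewrite /b; case: choice.unpickle => [[j k]|]; last by exists set0 => //; exact: compact0.
  case: asboolP => [[_ [K cK gK]]|_]; last by exists set0 => //; exact: compact0.
  exists K => // x nKx; apply/max_idPl; rewrite subr_le0 leNgt; apply/negP => jx.
  by apply: nKx; apply: gK; rewrite ballEmdist.
have b_pos x : O x -> exists i, 0 < b i x.
  move=> Ox; have [//|U Ux [cU _]] := lcE (x := x); rewrite withinET in Ux.
  have : nbhs x (U `&` O) by apply: filterI => //; exact: open_nbhs_nbhs.
  move=> /nbhs_ballP[q /= q0 qUO].
  have [k _ kq] := near_infty_natSinv_lt (PosNum (divr_gt0 q0 (ltr0Sn _ 1))).
  have {kq}kq : r k < q / 2 by exact: kq (leqnn k).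
  have [y [xy Dy]] : ball x (r k) `&` D !=set0.
    apply: dD; last exact: metric_ball_open.
    by exists x; exact: ballxx.
  have [j _ ejy] := De _ Dy.
  have gjk : ball (e j) (r k) `<=` U `&` O.
    move=> z; rewrite ejy => yz; apply: qUO.
    have := ball_triangle xy yz; rewrite !ballEmdist /=; move/lt_trans; apply.
    by rewrite [ltRHS]splitr ltrD.
  exists (choice.pickle (j, k)); rewrite /b choice.pickleK asboolT.
    rewrite lt_max ltxx /= subr_gt0 ejy.
    by have := ball_sym xy; rewrite ballEmdist.
  by split; [move=> z /gjk[]|exists U => // z /gjk[]].
pose h n x := \sum_(i < n) b i x.
have h_cont n : continuous (h n).
  elim: n => [|n IHn] x.
    by rewrite /h; under eq_fun do rewrite big_ord0; exact: cvg_cst.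
  rewrite /h; under eq_fun do rewrite big_ord_recr /=.
  by apply: cvgD; [exact: IHn|exact: b_cont].
(* The factor n lifts the sum above 1 at each point of [O] from some n on, so the truncation equals
   the indicator there, not merely in the limit. *)
exists (fun n x => Num.min 1 (n%:R * h n x)); split.
- move=> n x; apply: (@continuous_min _ _ (fun=> 1) (fun x => n%:R * h n x)).
    exact: cvg_cst.
  apply: cvgM; first exact: cvg_cst.
  exact: h_cont.
- move=> n; suff [K cK hK] : exists2 K, compact K & forall x, ~ K x -> h n x = 0.
    by exists K => // x /hK ->; rewrite mulr0; apply/min_idPr.
  rewrite /h; elim: n => [|n [K cK hK]].
    by exists set0 => [|x _]; [exact: compact0|rewrite big_ord0].
  have [K' cK' bK'] := b_cpt n; exists (K `|` K'); first exact: compactU.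
  move=> x nKK'; rewrite big_ord_recr /= hK ?bK' ?addr0// => Kx; apply: nKK'; [by right|by left].
- move=> n x; rewrite ge_min lexx /= le_min ler01 /= mulr_ge0//.
  by apply: sumr_ge0 => i _; exact: b_ge0.
- move=> x; have [Ox|nOx] := pselect (O x); last first.
    exists 0%N => n _; rewrite indicE memNset//=.
    rewrite /h big1 ?mulr0; first by apply/min_idPr.
    move=> i _; apply/eqP; rewrite eq_le b_ge0 andbT leNgt; apply/negP.
    by move/b_supp.
  have [i bi] := b_pos x Ox.
  have [N _ NP] := near_infty_natSinv_lt (PosNum bi).
  exists (maxn i.+1 N.+1) => n; rewrite geq_max => /andP[ni nN].
  rewrite indicE mem_set//=; apply/min_idPl.
  have hb : b i x <= h n x.
    rewrite /h (bigD1 (Ordinal ni)) //= lerDl.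
    by apply: sumr_ge0 => j _; exact: b_ge0.
  have n0 : 0 < n%:R :> R by rewrite ltr0n (leq_trans _ nN).
  rewrite -ler_pdivrMl// mulr1; apply: le_trans hb.
  have := NP N (leqnn N) => /= /ltW; apply: le_trans.
  by rewrite lef_pV2 ?posrE// ler_nat.
Qed.

End BumpFunctions.

Lemma measure1_bounded_integrable d (Om : measurableType d) (R : realType)
    (mu : {measure set Om -> \bar R}) (f : Om -> R) (c : R) :
  mu setT = 1%E -> measurable_fun setT f -> (forall w, `|f w| <= c) ->
  mu.-integrable setT (EFin \o f).
Proof.
move=> mu1 mf fc; apply: measurable_bounded_integrable => //.
  by rewrite mu1 ltry.
exists c; split; first exact: num_real.
by move=> M cM w _ /=; apply: le_trans (fc w) (ltW cM).
Qed.

Lemma measure1_dominated_cvg d (Om : measurableType d) (R : realType)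
    (mu : {measure set Om -> \bar R}) (D : set Om) (f : nat -> Om -> R)
    (g : Om -> R) (c : R) :
  mu setT = 1%E -> measurable D -> (forall n, measurable_fun setT (f n)) ->
  (forall n w, `|f n w| <= c) ->
  (forall w, f n w @[n --> \oo] --> g w) ->
  (\int[mu]_(w in D) (f n w)%:E @[n --> \oo] --> \int[mu]_(w in D) (g w)%:E)%E.
Proof.
move=> mu1 mD mf fc fg.
apply: (@dominated_cvg _ _ _ mu D mD (fun n w => (f n w)%:E) (fun w => (g w)%:E)
  (cst c%:E)) => //.
- by move=> n; apply/measurable_EFinP; apply: measurable_funTS; exact: mf.
- by move=> w _; apply: cvg_EFin (fg w); exact: nearW.
- apply: (@integrableS _ _ _ mu setT D) => //.
  by apply: (measure1_bounded_integrable (c := `|c|)) => //; exact: measurable_cst.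
- by move=> n w _; rewrite lee_fin.
Qed.

Section WeakContinuity.
Context (R : realType) (E : pmetricType R) (Z : topologicalType).
Hypotheses (lcE : locally_compact [set: E]) (sepE : separable E).
Variable mu : Z -> {measure set (borel E) -> \bar R}.
Hypothesis mu1 : forall z, mu z setT = 1%E.
Hypothesis mu_cont : forall f : E -> R, C0 f ->
  continuous (fun z => \int[mu z]_y f y : R).
Variables (H : Z -> E -> R) (c : R).
Hypothesis H_cont : continuous (fun p : Z * E => H p.1 p.2).
Hypothesis H_bnd : forall z y, 0 <= H z y <= c.

Let Hz_cont z : continuous (H z).
Proof.
move=> y; apply: (@continuous_comp _ _ _ (pair z) (fun p => H p.1 p.2)).
  by apply: cvg_pair => //; exact: cvg_cst.
exact: H_cont.
Qed.

(** Three losses of [e / 3]: cutting [H z0] by a compactly supported [phi n], moving the measure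
    from [z0] to z against that C_0 function, and replacing [H z0] by [H z] on the compact support.
    Since [H] is nonnegative, removing the cut only increases the integral, so one side of
    continuity results. *)
Lemma integral_lsc (z0 : Z) (e : R) : 0 < e ->
  \forall z \near z0, \int[mu z0]_y H z0 y - e < \int[mu z]_y H z y.
Proof.
move=> e0.
have c0 : 0 <= c by have /andP[] := H_bnd z0 point; exact: le_trans.
have Hm z : measurable_fun setT (H z : borel E -> R) by exact: continuous_borel_measurable.
have Hi z z' : (mu z).-integrable setT (EFin \o H z' : borel E -> \bar R).
  apply: (measure1_bounded_integrable (c := c)) => // y.
  by have /andP[H0 Hc] := H_bnd z' y; rewrite ger0_norm.
have [phi [phi_cont phi_cpt phi01 phi_lim]] := open_bumps lcE sepE (@openT E).
have fm n z : measurable_fun setT ((fun y => phi n y * H z y) : borel E -> R).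
  by apply: measurable_funM => //; exact: continuous_borel_measurable.
have fle n z y : 0 <= phi n y * H z y <= H z y.
  have /andP[p0 p1] := phi01 n y; have /andP[H0 _] := H_bnd z y.
  by rewrite mulr_ge0//= ler_piMl.
have fi n z z' : (mu z).-integrable setT
    (EFin \o (fun y => phi n y * H z' y) : borel E -> \bar R).
  apply: (measure1_bounded_integrable (c := c)) => // y.
  have /andP[f0 fH] := fle n z' y; have /andP[H0 Hc] := H_bnd z' y.
  by rewrite ger0_norm//; exact: le_trans fH Hc.
have e30 : 0 < e / 3%:R by rewrite divr_gt0.
have [n phin] : exists n,
    \int[mu z0]_y H z0 y - e / 3%:R < \int[mu z0]_y (phi n y * H z0 y).
  have : (\int[mu z0]_y (phi n y * H z0 y)%:E @[n --> \oo] -->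
      \int[mu z0]_y (H z0 y)%:E)%E.
    apply: (@measure1_dominated_cvg _ (borel E) _ _ _ _ _ c) => //.
      move=> n y; have /andP[f0 fH] := fle n z0 y; have /andP[H0 Hc] := H_bnd z0 y.
      by rewrite ger0_norm//; exact: le_trans fH Hc.
    move=> y; have [N NP] := phi_lim y; apply: cvg_near_cst.
    exists N => // n /= /NP ->; by rewrite indicT mul1r.
  rewrite -(fineK (integrable_fin_num measurableT (Hi z0 z0))).
  move/fine_cvgP => [_] /cvgrPdist_lt /(_ _ e30)[N _ /(_ N (leqnn N))] /= dN.
  exists N; rewrite /Rintegral ltrBlDl -ltrBlDr.
  exact: le_lt_trans (ler_norm _) dN.
have [K cK phiK] := phi_cpt n.
have near1 : \forall z \near z0,
    \int[mu z0]_y (phi n y * H z0 y) - e / 3%:R < \int[mu z]_y (phi n y * H z0 y).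
  have fC0 : C0 (fun y => phi n y * H z0 y).
    split; first by move=> y; apply: cvgM; [exact: phi_cont|exact: Hz_cont].
    by move=> q q0; exists K => // y nKy; rewrite phiK// mul0r normr0.
  have /cvgrPdist_lt/(_ _ e30) := mu_cont fC0 (x := z0).
  apply: filterS => z dz; rewrite ltrBlDl -ltrBlDr.
  exact: le_lt_trans (ler_norm _) dz.
have near2 : \forall z \near z0, forall y, K y -> `|H z0 y - H z y| < e / 3%:R.
  apply: (compact_near_coveringP K).1 => // y Ky.
  (* The difference of [H z0] and [H z] at a nearby point passes through [H z0 y], hence two halves
     of [e / 3]. *)
  have e60 : 0 < e / 6%:R by rewrite divr_gt0.
  have /cvgrPdist_lt/(_ _ e60) near_zy := @H_cont (z0, y).
  have /cvgrPdist_lt/(_ _ e60) near_y := @Hz_cont z0 y.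
  have [[A B] /= [zA yB] AB] := near_zy.
  exists ([set y' | B y' /\ `|H z0 y - H z0 y'| < e / 6%:R], A) => /=.
    by split => //; exact: filterI.
  move=> [y' z] /= [[By' dy'] Az].
  have := AB (z, y') (conj Az By') => /= dz.
  have -> : e / 3%:R = e / 6%:R + e / 6%:R by field.
  have := ler_normD (H z0 y - H z y') (H z0 y' - H z0 y).
  have -> : H z0 y - H z y' + (H z0 y' - H z0 y) = H z0 y' - H z y' by ring.
  rewrite (distrC (H z0 y') (H z0 y)).
  by move/le_lt_trans; apply; exact: ltrD.
apply: filterS2 near1 near2 => z dphi dK.
have Ki : \int[mu z]_y (phi n y * H z0 y) - e / 3%:R <= \int[mu z]_y H z y.
  have -> : e / 3%:R = \int[mu z]_y cst (e / 3%:R) y.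
    by rewrite Rintegral_cst// mu1 /= mulr1.
  have ci : (mu z).-integrable setT (EFin \o cst (e / 3%:R) : borel E -> \bar R).
    by apply: (measure1_bounded_integrable (c := `|e / 3%:R|)) => //; exact: measurable_cst.
  rewrite -RintegralB//; apply: le_Rintegral => //.
    apply: (measure1_bounded_integrable (c := c + e / 3%:R)) => //.
      by apply: measurable_funB => //; exact: fm.
    move=> y; apply: le_trans (ler_normB _ _) _; apply: lerD; last by rewrite ger0_norm// ltW.
    have /andP[f0 fH] := fle n z0 y; have /andP[H0 Hc] := H_bnd z0 y.
    by rewrite ger0_norm//; exact: le_trans fH Hc.
  move=> y _ /=; have /andP[f0 fH] := fle n z y; have /andP[p0 p1] := phi01 n y.
  have [Ky|nKy] := pselect (K y).
    have : phi n y * (H z0 y - H z y) <= e / 3%:R.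
      apply: le_trans (ler_norm _) _; rewrite normrM (ger0_norm p0).
      apply: le_trans (ltW (dK y Ky)); rewrite ler_piMl//.
    by rewrite mulrBr; lra.
  rewrite phiK// mul0r sub0r; apply: le_trans (_ : 0 <= _); first by rewrite oppr_le0 ltW.
  by have /andP[] := H_bnd z y.
apply: lt_le_trans Ki; move: phin dphi; set a := Rintegral _ _ _.
set b := Rintegral _ _ _; set b' := Rintegral _ _ _ => phin dphi; lra.
Qed.

End WeakContinuity.

(** Lower semicontinuity is applied to [H] and to [c - H]; because every [mu z] has mass 1, the
    second gives upper semicontinuity for [H]. *)
Lemma integral_weak_continuous (R : realType) (E : pmetricType R)
    (Z : topologicalType) (lcE : locally_compact [set: E]) (sepE : separable E)
    (mu : Z -> {measure set (borel E) -> \bar R}) (H : Z -> E -> R) (c : R) :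
  (forall z, mu z setT = 1%E) ->
  (forall f : E -> R, C0 f -> continuous (fun z => \int[mu z]_y f y : R)) ->
  continuous (fun p : Z * E => H p.1 p.2) -> (forall z y, 0 <= H z y <= c) ->
  continuous (fun z => \int[mu z]_y H z y : R).
Proof.
move=> mu1 mu_cont H_cont H_bnd z0; apply/cvgrPdist_lt => e e0.
have H_lsc := integral_lsc lcE sepE mu1 mu_cont H_cont H_bnd z0 e0.
have cH_cont : continuous (fun p : Z * E => c - H p.1 p.2).
  by move=> p; apply: cvgB; [exact: cvg_cst|exact: H_cont].
have cH_bnd z y : 0 <= c - H z y <= c.
  by have /andP[H0 Hc] := H_bnd z y; rewrite subr_ge0 Hc lerBlDr lerDl.
have := integral_lsc (H := fun z y => c - H z y) lcE sepE mu1 mu_cont cH_cont cH_bnd z0 e0.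
have Hz_cont z : continuous (H z).
  move=> y; apply: (@continuous_comp _ _ _ (pair z) (fun p => H p.1 p.2)).
    by apply: cvg_pair => //; exact: cvg_cst.
  exact: H_cont.
have Hi z : (mu z).-integrable setT (EFin \o H z : borel E -> \bar R).
  apply: (measure1_bounded_integrable (c := c)) => //.
    exact: continuous_borel_measurable.
  by move=> y; have /andP[H0 Hc] := H_bnd z y; rewrite ger0_norm.
have ci z : (mu z).-integrable setT (EFin \o cst c : borel E -> \bar R).
  by apply: (measure1_bounded_integrable (c := `|c|)) => //; exact: measurable_cst.
have cHE z : \int[mu z]_y (c - H z y) = c - \int[mu z]_y H z y.
  rewrite (@RintegralB _ _ _ (mu z) setT (cst c) (H z))//.
  by rewrite Rintegral_cst// mu1 /= mulr1.
apply: filterS2 H_lsc => z; rewrite !cHE.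
set a := \int[mu z0]_y _; set b := \int[mu z]_y _ => ab ba.
by rewrite ltr_norml; apply/andP; split; lra.
Qed.

(** * Extremal representations and intersection-closed lists *)

Section ExtremalRepresentation.
Context (R : realType) (T : metricType R) (I : indexing_collection T).
Implicit Types (A B U V W M : set T) (D X : set (set T)).
Variables (B : set T) (D : set (set T)).
Hypotheses (fD : finite_set D) (D0 : D !=set0) (Di : D `<=` idx I).
Hypothesis BE : B = \bigcup_(V in D) V.

(** Shape used twice squeezes a member of [D] between two sets of an extremal representation, which
    are therefore equal. *)
Lemma ext_comp_sub : ext_comp I B `<=` D.
Proof.
move=> U [D' [fD' D'i D'anti D'B] D'U].
have D'0 : D' !=set0 by exists U.
have [|V DV UV] := idx_shape (D'i _ D'U) fD D0 Di.
  by move=> x Ux; rewrite -BE -D'B; exists U.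
have [|U' D'U' VU'] := idx_shape (Di DV) fD' D'0 D'i.
  by move=> x Vx; rewrite D'B BE; exists V.
have UU' := D'anti _ _ D'U D'U' (subset_trans UV VU').
by suff -> : U = V by []; apply/seteqP; split => //; rewrite UU'.
Qed.

(** The maximal elements of [D] form an extremal representation. *)
Lemma ext_comp_above V : D V -> exists2 W, ext_comp I B W & V `<=` W.
Proof.
move=> DV; have [W DW [VW Wmax]] := finite_set_maximal fD DV.
exists W => //.
exists [set U | D U /\ forall U', D U' -> U `<=` U' -> U' = U] => //; split.
- by apply: sub_finite_set fD => U [].
- by move=> U [/Di].
- by move=> U U' [DU Umax] [DU' _] UU'; rewrite (Umax U').
- rewrite BE; apply/seteqP; split=> [x [U [DU _] Ux]|x [U DU Ux]]; first by exists U.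
  have [U' DU' [UU' U'max]] := finite_set_maximal fD DU.
  by exists U' => //; exact: UU'.
Qed.

End ExtremalRepresentation.

Lemma finite_set_ind_D1 (K : choiceType) (Q : set K -> Prop) :
  (forall X, finite_set X -> (forall x, X x -> Q (X `\ x)) -> Q X) ->
  forall X, finite_set X -> Q X.
Proof.
move=> QP X fX; have [n] := ubnP #|` fset_set X|.
elim: n X fX => // n IHn X fX Xn; apply: QP => // x Xx.
apply: IHn; first exact: finite_setD.
by move: Xn; rewrite fset_setD1// (cardfsD1 x) in_fset_set// mem_set.
Qed.

Section IntersectionLists.
Context (R : realType) (T : metricType R) (I : indexing_collection T).
Implicit Types (A B U V W M : set T) (D X : set (set T)) (r : seq (set T)).

Fixpoint dom r : set (set T) :=
  if r is M :: r' then M |` dom r' else [set bot I].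

(* The list enumerates, in reverse order, a class containing bot whose initial
   segments are all closed under intersections. *)
Fixpoint chain r : Prop :=
  if r is M :: r' then
    [/\ chain r', idx I M & forall V, dom r' V -> dom r' (V `&` M)]
  else True.

(** The complement of [below r M] in [M] is what [M] adds to the earlier sets. Intersecting with [M]
    respects the convention that the removed part of an increment lies in its first set. *)
Definition below r M := \bigcup_(V in [set V `&` M | V in dom r]) V.

Lemma dom_bot r : dom r (bot I).
Proof. by elim: r => //= M r IHr; right. Qed.

Lemma dom_finite r : finite_set (dom r).
Proof.
elim: r => [|M r IHr] /=; first exact: finite_set1.
by rewrite finite_setU; split => //; exact: finite_set1.
Qed.

Lemma dom_idx r : chain r -> dom r `<=` idx I.
Proof.
elim: r => [_ _ ->|M r IHr [/IHr ri iM _] V [->|/ri]//]; exact: idx_bot.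
Qed.

Lemma domI r V W : chain r -> dom r V -> dom r W -> dom r (V `&` W).
Proof.
elim: r => [_ -> ->|M r IHr [/IHr{}IHr _ rM]] /=; first by rewrite setIid.
move=> [->|rV] [->|rW]; first by rewrite setIid; left.
- by right; rewrite setIC; exact: rM.
- by right; exact: rM.
- by right; exact: IHr.
Qed.

Lemma dom_bigcap r D : chain r -> D !=set0 -> D `<=` dom r -> dom r (\bigcap_(V in D) V).
Proof.
elim: r D => [|M r IHr] D /=.
  move=> _ [V DV] Db; rewrite (_ : D = [set bot I]) ?bigcap_set1//.
  by apply/seteqP; split => // _ ->; rewrite -(Db _ DV).
move=> [cr iM rM] D0 DMr; pose D' := D `&` dom r.
have [D'0|D'0] := pselect (D' !=set0); last first.
  left; rewrite (_ : D = [set M]) ?bigcap_set1//.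
  have DM V : D V -> V = M.
    by move=> DV; have [//|rV] := DMr _ DV; exfalso; apply: D'0; exists V.
  apply/seteqP; split => // _ ->; have [V DV] := D0.
  by rewrite -(DM _ DV).
have rD' : dom r (\bigcap_(V in D') V) by apply: IHr => // V [].
right; have [DM|nDM] := pselect (D M).
  rewrite (_ : D = M |` D') ?bigcap_setU1 1?setIC; first exact: rM.
  apply/seteqP; split=> [V DV|V [->//|[]//]].
  by have [->|rV] := DMr _ DV; [left|right].
rewrite (_ : D = D')//; apply/seteqP; split=> [V DV|V []//].
by have [VM|rV] := DMr _ DV; [exfalso; apply: nDM; rewrite -VM|split].
Qed.

(** A maximal element M can be removed and put at the head: if V cap W were M, then V would contain
    M and equal it, so the rest is still closed under intersections. *)
Lemma chain_enum X : finite_set X -> X `<=` idx I -> X (bot I) ->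
  (forall V W, X V -> X W -> X (V `&` W)) -> exists2 r, chain r & dom r = X.
Proof.
move: X; apply: finite_set_ind_D1 => X fX IHX Xi Xb XI.
have [M XM [_ Mmax]] := finite_set_maximal fX Xb.
have [Mb|Mb] := pselect (M = bot I).
  exists [::] => //=; apply/seteqP; split=> [_ ->//|V XV].
  by rewrite -Mb; apply: Mmax => //; rewrite Mb; apply: bot_sub; exact: Xi.
have XMI V W : (X `\ M) V -> X W -> (X `\ M) (V `&` W).
  move=> [XV VM] XW; split; first exact: XI.
  by move=> /= VW; apply: VM; apply: Mmax => //; rewrite -VW; exact: subIsetl.
have [|||r cr rE] := IHX _ XM.
- by move=> V [/Xi].
- by split => //= bM; exact: Mb.
- by move=> V W XMV [XW _]; exact: XMI.
exists (M :: r) => /=; last by rewrite rE setD1K.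
split => //; first exact: Xi.
by move=> V; rewrite rE => XMV; exact: XMI.
Qed.

Lemma chain_add r A : chain r -> idx I A ->
  exists2 r', chain r' & dom r `<=` dom r' /\ dom r' A.
Proof.
move=> cr iA; pose X := dom r `|` (A |` [set V `&` A | V in dom r]).
have [||||r' cr' r'E] := @chain_enum X.
- rewrite !finite_setU; split; first exact: dom_finite.
  by split; [exact: finite_set1|apply: finite_image; exact: dom_finite].
- have ri := dom_idx cr.
  by move=> V [/ri//|[->//|[W /ri iW <-]]]; exact: idx_setI.
- by left; exact: dom_bot.
- have rI V W : dom r V -> dom r W -> X (V `&` W) by left; exact: domI.
  have rA V : dom r V -> X (V `&` A) by right; right; exists V.
  have rIA V W : dom r V -> dom r W -> X (V `&` W `&` A).
    by move=> rV rW; right; right; exists (V `&` W) => //; exact: domI.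
  move=> V W [rV|[->|[V' rV' <-]]] [rW|[->|[W' rW' <-]]].
  + exact: rI.
  + exact: rA.
  + by rewrite setIA; exact: rIA.
  + by rewrite setIC; exact: rA.
  + by rewrite setIid; right; left.
  + by rewrite setIC -setIA setIid; exact: rA.
  + by rewrite setIAC; exact: rIA.
  + by rewrite -setIA setIid; exact: rA.
  + by rewrite setIACA setIid; exact: rIA.
by exists r' => //; rewrite r'E; split; [move=> V rV; left|right; left].
Qed.

Lemma chain_cover (s : seq (set T)) : (forall A, List.In A s -> idx I A) ->
  exists2 r, chain r & forall A, List.In A s -> dom r A.
Proof.
elim: s => [_|A s IHs si]; first by exists [::].
have [B sB|r cr rs] := IHs; first by apply: si; right.
have [r' cr' [rr' r'A]] := chain_add cr (si A (or_introl erefl)).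
by exists r' => // B [<-//|/rs]; exact: rr'.
Qed.

Section Below.
Variables (r : seq (set T)) (M : set T).
Hypotheses (cMr : chain (M :: r)).

Let cr : chain r. Proof. by case: cMr. Qed.
Let iM : idx I M. Proof. by case: cMr. Qed.
Let D := [set V `&` M | V in dom r].
Let Dr : D `<=` dom r. Proof. by case: cMr => _ _ rM _ [V rV <-]; exact: rM. Qed.
Let fD : finite_set D. Proof. by apply: finite_image; exact: dom_finite. Qed.
Let D0 : D !=set0.
Proof. by exists (bot I `&` M); exists (bot I) => //; exact: dom_bot. Qed.
Let Di : D `<=` idx I. Proof. by apply: subset_trans Dr _; exact: dom_idx. Qed.

Lemma increment_below : increment I M (below r M).
Proof.
split=> //; first by exists D.
by move=> x [_ [V _ <-]] [].
Qed.

(** The kernel for [M] thus reads only coordinates treated earlier. *)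
Lemma AC_below : Defs.AC I M (below r M) `<=` dom r.
Proof.
have ext_r : ext_comp I (below r M) `<=` dom r.
  by apply: subset_trans Dr; exact: ext_comp_sub.
move=> _ [[MB ->]|[_ [D' [D'0 D'ext ->]] _]]; last first.
  by apply: dom_bigcap => //; exact: subset_trans D'ext ext_r.
(* Degenerate increment: if the earlier sets cover [M], Shape shows that [M] is already one of
   them. *)
have [|V DV MV] := idx_shape iM fD D0 Di; first by rewrite {1}MB.
suff -> : M = V by exact: Dr.
by apply/seteqP; split => //; have [W _ <-] := DV; exact: subIsetr.
Qed.

Variables (th : shift_family I) (U : set T).
Hypothesis iU : idx I U.

(** It makes the shifted earlier sets disjoint from the shifted increment, so that their
    sigma-fields enter [Gstar]. *)
Lemma theta_belowP V : dom r V ->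
  theta th U V `&` theta th U M `<=` theta_union th U (below r M).
Proof.
move=> rV; have iV := dom_idx cr rV.
rewrite -theta_cap//.
have [|W extW VW] := ext_comp_above fD Di erefl (V := V `&` M); first by exists V.
have iW : idx I W by apply: Di; exact: ext_comp_sub extW.
have VMW : theta th U (V `&` M) `<=` theta th U W.
  by apply: theta_subr => //; exact: idx_setI.
by move=> x /VMW Wx; exists W.
Qed.

Lemma increment_theta_below :
  increment I (theta th U M) (theta_union th U (below r M)).
Proof.
have extD : ext_comp I (below r M) `<=` D by exact: ext_comp_sub.
split; first exact: theta_idx.
  exists [set theta th U V | V in ext_comp I (below r M)]; split.
  - by apply: finite_image; exact: sub_finite_set extD fD.
  - have [V DV] := D0; have [W extW _] := ext_comp_above fD Di erefl DV.
    by exists (theta th U W); exists W.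
  - by move=> _ [V /extD/Di iV <-]; exact: theta_idx.
  - by rewrite bigcup_image.
move=> x [V /extD[W rW <-]].
by apply: theta_subr => //; apply: idx_setI => //; exact: (dom_idx cr rW).
Qed.

End Below.

End IntersectionLists.

Lemma integral_giry_map d d' (Om : measurableType d) (Om' : measurableType d')
    (R : realType) (phi : Om -> Om') (mphi : measurable_fun setT phi)
    (mu : giry Om R) (D : set Om') (f : Om' -> \bar R) :
  measurable D -> measurable_fun setT f ->
  (\int[giry_map mphi mu]_(y in D) f y =
   \int[mu]_(w in phi @^-1` D) f (phi w))%E.
Proof.
move=> mD mf; have mfD : measurable_fun D f by exact: measurable_funTS.
rewrite integralE [RHS]integralE; congr (_ - _)%E.
- under [RHS]eq_integral do rewrite (funepos_comp f phi).
  have := @ge0_integral_pushforward _ _ _ _ _ _ mphi mu D (f^\+)%E mD.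
  by apply => //; exact: measurable_funepos.
- under [RHS]eq_integral do rewrite (funeneg_comp f phi).
  have := @ge0_integral_pushforward _ _ _ _ _ _ mphi mu D (f^\-)%E mD.
  by apply => //; exact: measurable_funeneg.
Qed.

(** * Conditional expectations and transition kernels *)

Section SubSigmaAlgebra.
Local Open Scope ereal_scope.
Context (R : realType) d (Om : measurableType d) (Pr : probability Om R).
Variable G : set (set Om).
Hypotheses (sG : sigma_algebra setT G) (Gm : G `<=` measurable).

Local Notation OmG := (g_sigma_algebraType G).

Let measurableG (S : set Om) : @measurable _ OmG S = G S.
Proof. by rewrite -[LHS]/(<<s G>> S) sigma_algebra_id. Qed.

Let measurable_id : measurable_fun setT (idfun : Om -> OmG).
Proof.
move=> _ S; rewrite -[measurable S]/(@measurable _ OmG S) measurableG => GS.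
by rewrite setTI; exact: Gm.
Qed.

(** The restriction of [Pr] to [G], obtained as an image under the identity so that integration
    theory applies on the smaller sigma-field. *)
Let Q : giry OmG R := giry_map measurable_id (Pr : giry Om R).

Let integral_Q D (f : Om -> \bar R) : G D -> measurable_fun setT (f : OmG -> \bar R) ->
  \int[Q]_(w in D) f w = \int[Pr]_(w in D) f w.
Proof.
move=> GD mf; have mD : @measurable _ OmG D by rewrite measurableG.
exact: (integral_giry_map measurable_id (Pr : giry Om R) mD mf).
Qed.

Lemma cond_exp_measurable (W : Om -> \bar R) :
  (forall Y : set (\bar R), measurable Y -> G (W @^-1` Y)) ->
  measurable_fun setT (W : OmG -> \bar R).
Proof. by move=> GW _ Y mY; rewrite setTI measurableG; exact: GW. Qed.

(** The bounds make [V] integrable; equal integrals over all events of [G] then force almost sure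
    equality, by uniqueness under [Q]. *)
Lemma is_cond_exp_unique (Z V W : Om -> \bar R) :
  is_cond_exp Pr G Z V -> is_cond_exp Pr G Z W -> (forall w, 0 <= V w <= 1) ->
  {ae Pr, forall w, V w = W w}.
Proof.
move=> [_ GV ZV] [_ GW ZW] V01.
have mV := cond_exp_measurable GV; have mW := cond_exp_measurable GW.
have iV : Q.-integrable setT V.
  apply: (@le_integrable _ OmG _ Q setT measurableT V (cst 1)) => //.
    by move=> w _; have /andP[V0 V1] := V01 w; rewrite gee0_abs// (le_trans V1)// lee_fin normr1.
  apply/integrableP; split; first exact: measurable_cst.
  under eq_integral do rewrite /= normr1.
  rewrite integral_cst// mul1e; apply: le_lt_trans (@sprobability_setT _ _ _ Q) _.
  by rewrite ltry.
have [|N [mN QN NVW]] := @integral_ae_eq _ OmG _ Q setT measurableT W V iV mW.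
  move=> D _; rewrite measurableG => GD.
  by rewrite !integral_Q// ZV// ZW.
exists N; split; first by apply: Gm; rewrite -measurableG.
  exact: QN.
by move=> w /= nVW; apply: NVW => /= VW; apply: nVW; exact: VW.
Qed.

End SubSigmaAlgebra.

Section PowerSpace.
Context (R : realType) (E : pmetricType R) (J : Type).

Lemma measurable_Epow_coord (V : J) :
  measurable_fun setT ((fun x => x V) : Epow E J -> borel E).
Proof.
move=> _ G mG; rewrite setTI; apply: sub_sigma_algebra.
by exists V; exists G.
Qed.

Lemma measurable_Epow d (Om : measurableType d) (f : Om -> Epow E J) :
  (forall V, measurable_fun setT ((fun w => f w V) : Om -> borel E)) ->
  measurable_fun setT f.
Proof.
move=> mf; apply: (@measurability _ _ _ (Epow E J) setT f (@cylinders _ E J)) => //.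
move=> _ [_ [V [G mG ->]] <-]; rewrite setTI.
by have := mf V measurableT G mG; rewrite setTI.
Qed.

End PowerSpace.

Section MarkovTransition.
Context (R : realType) (T : metricType R) (E : pmetricType R).
Context (I : indexing_collection T) (P : transition_system E I).
Context d (Om : measurableType d) (Pr : probability Om R).
Variables (F : set T -> set (set Om)) (X : set T -> Om -> E).
Hypotheses (filtF : filtration I Pr F) (markovX : C_markov I Pr F X).
Hypothesis transX : has_transitions Pr X P.

Lemma AC_idx A B : idx I A -> Defs.AC I A B `<=` idx I.
Proof.
move=> iA V [[_ ->]//|[_ [D [D0 Dext ->]] _]].
by apply: idx_bigcap => // W /Dext[D' [_ D'i _ _]]; exact: D'i.
Qed.

Let adX : adapted I F X. Proof. by case: markovX. Qed.

Lemma path_measurable J : J `<=` idx I ->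
  measurable_fun setT (path_of X J : Om -> Epow E J).
Proof.
move=> Ji; apply: measurable_Epow => V.
by apply: (adapted_measurable filtF adX); apply: Ji; exact: set_valP.
Qed.

Lemma Gstar_measurable A B : Gstar I F A B `<=` measurable.
Proof.
apply: smallest_sub; first exact: sigma_algebra_measurable.
by move=> H [B' _]; exact: ext_filt_measurable filtF _ _.
Qed.

(** The kernel is a version given the vector X_C only. Uniqueness identifies it with [W2], and the
    Markov property with [W1], which may be integrated over any event of [Gstar]. *)
Lemma markov_transition A B (S : set Om) (G : set (borel E)) :
  increment I A B -> Gstar I F A B S -> measurable G ->
  (Pr (S `&` X A @^-1` G) =
   \int[Pr]_(w in S) trans P A B (path_of X (Defs.AC I A B) w) G)%E.
Proof.
move=> incAB GS mG; have [iA _ _] := incAB.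
have mS := Gstar_measurable GS.
have mXA := adapted_measurable filtF adX iA.
have bnd1 : exists M : R, forall x : borel E, `|\1_G x| <= M.
  by exists 1 => x; rewrite indicE; case: (_ \in _); rewrite ?normr1// normr0.
have m1 : measurable_fun setT (\1_G : borel E -> R) by exact: measurable_indic.
have [W1 [W2 [[_ GW1 W1Z] W2P W12]]] := markovX.2 A B incAB _ m1 bnd1.
have VP := transX incAB mG.
have sXC : sigma_algebra setT (sigma_XC I X A B).
  rewrite (_ : sigma_XC _ _ _ _ = preimage_set_system setT
     (path_of X (Defs.AC I A B)) (measurable : set (set (Epow E (Defs.AC I A B))))).
    by apply: sigma_algebra_preimage; exact: sigma_algebra_measurable.
  apply/seteqP; split=> [_ [C mC <-]|_ [C mC <-]]; exists C => //; by rewrite setTI.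
have XCm : sigma_XC I X A B `<=` measurable.
  move=> _ [C mC <-]; rewrite -[_ @^-1` _]setTI.
  by apply: path_measurable => //; exact: AC_idx.
have V01 w : (0 <= trans P A B (path_of X (Defs.AC I A B) w) G <= 1)%E.
  rewrite measure_ge0 /= -(prob_kernel (s := trans P A B) (path_of X (Defs.AC I A B) w)).
  apply: le_measure; [exact: mem_set|apply: mem_set; exact: measurableT|exact: subsetT].
have W2V := is_cond_exp_unique sXC XCm VP W2P V01.
have mW1 : measurable_fun setT W1.
  by move=> _ Y mY; rewrite setTI; apply: Gstar_measurable; exact: GW1.
have mV : measurable_fun setT (fun w => trans P A B (path_of X (Defs.AC I A B) w) G).
  by move=> _ Y mY; rewrite setTI; apply: XCm; case: VP => _ + _; apply.
transitivity (\int[Pr]_(w in S) (\1_G (X A w))%:E)%E.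
  rewrite setIC -integral_indic//; last by rewrite -[_ @^-1` _]setTI; exact: mXA.
rewrite -W1Z//; apply: ae_eq_integral => //; try exact: measurable_funTS.
by apply: filterS2 W12 W2V => w -> ->.
Qed.

End MarkovTransition.

Section KernelPullback.
Context d d' d'' (W : measurableType d) (Y : measurableType d')
  (Z : measurableType d'') (R : realType).
Variables (k : R.-pker Y ~> Z) (f : W -> Y).

(** The proof [mf] is an argument so that the kernel structure can be attached to the term. *)
Definition kpull (mf : measurable_fun setT f) (w : W) :
  {measure set Z -> \bar R} := k (f w).

Hypothesis mf : measurable_fun setT f.

Let measurable_kpull U : measurable U -> measurable_fun setT (kpull mf ^~ U).
Proof. by move=> mU; exact: (measurableT_comp (measurable_kernel k _ mU) mf). Qed.

HB.instance Definition _ := isKernel.Build _ _ _ _ _ (kpull mf) measurable_kpull.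

Let kpull_prob w : kpull mf w setT = 1%E.
Proof. exact: prob_kernel. Qed.

HB.instance Definition _ :=
  Kernel_isProbability.Build _ _ _ _ _ (kpull mf) kpull_prob.

End KernelPullback.

Section TotalMass1.
Context d (Z : measurableType d) (R : realType).
Variables (mu : {measure set Z -> \bar R}).

Definition subprob_of (mu1 : mu setT = 1%E) : set Z -> \bar R := mu.
Hypothesis mu1 : mu setT = 1%E.

HB.instance Definition _ := Measure.on (subprob_of mu1).

Let subprob_of_le1 : (subprob_of mu1 setT <= 1)%E.
Proof. by rewrite /subprob_of mu1. Qed.

HB.instance Definition _ :=
  Measure_isSubProbability.Build _ _ _ (subprob_of mu1) subprob_of_le1.

Definition giry_of : giry Z R := subprob_of mu1.

End TotalMass1.

(** * Iterated kernels on full families of states *)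

Section StateSpace.
Context (R : realType) (T : metricType R) (E : pmetricType R).
Context (I : indexing_collection T) (P : transition_system E I).
Implicit Types (A B U V M : set T) (r : seq (set T)) (z : idx I -> E).

Definition bot_pt : idx I := exist _ (bot I) (mem_set (idx_bot I)).

(** Extends a family to all sets, the form expected by [restr] and [upd]; sets outside the
    collection read the value at [bot I]. *)
Definition coord z V : E := z (insubd bot_pt V).

Lemma coordK z (V : idx I) : coord z (val V) = z V.
Proof. by rewrite /coord valKd. Qed.

Lemma coord_restr (x : set T -> E) V : idx I V ->
  coord (restr x : idx I -> E) V = x V.
Proof. by move=> iV; rewrite /coord /restr insubdK//; exact: mem_set. Qed.

Definition updz z M (y : E) : idx I -> E := restr (upd (coord z) M y).

Lemma updzE z M y (V : idx I) : updz z M y V = if `[< val V = M >] then y else z V.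
Proof. by rewrite /updz /restr /upd coordK. Qed.

Lemma coord_updz z M y V : idx I V ->
  coord (updz z M y) V = if `[< V = M >] then y else coord z V.
Proof. by move=> iV; rewrite /updz coord_restr. Qed.

Definition step r M (h : (idx I -> E) -> \bar R) z : \bar R :=
  (\int[trans P M (below I r M) (restr (coord z))]_y h (updz z M y))%E.

(** The head of the list is the last set added, so it is integrated out first. At the end only the
    state at [bot I] is left, and the constant family agrees with the value of [rho] on the empty
    list. *)
Fixpoint chain_int r (h : (idx I -> E) -> \bar R) (x : E) : \bar R :=
  if r is M :: r' then chain_int r' (step r' M h) x else h (fun=> x).

(* Keeps the coordinates in dom r and replaces all the others by that of bot. *)
Fixpoint rho r z : idx I -> E :=
  if r is M :: r' then updz (rho r' z) M (coord z M) else fun=> coord z (bot I).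

Lemma coord_rho r z V : chain I r -> dom I r V -> coord (rho r z) V = coord z V.
Proof.
elim: r V => [V _ ->|M r IHr V [cr iM rM]] /=; first by [].
move=> rV; have iV : idx I V by apply: (@dom_idx _ _ _ (M :: r)).
rewrite coord_updz//; case: asboolP => [->//|VM].
by case: rV => // rV; exact: IHr.
Qed.

Lemma measurable_coord V :
  measurable_fun setT ((fun z => coord z V) : Epow E (idx I) -> borel E).
Proof. exact: measurable_Epow_coord. Qed.

Lemma measurable_restr_coord (J : set (set T)) :
  measurable_fun setT ((fun z => restr (coord z)) : Epow E (idx I) -> Epow E J).
Proof. by apply: measurable_Epow => V; exact: measurable_coord. Qed.

Lemma measurable_updz M : measurable_fun setT
  ((fun p => updz p.1 M p.2) : Epow E (idx I) * borel E -> Epow E (idx I)).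
Proof.
apply: measurable_Epow => V.
rewrite (_ : (fun p => _) = fun p => if `[< val V = M >] then p.2 else p.1 V).
  by case: asboolP => _; [exact: measurable_snd|
    exact: (measurableT_comp (measurable_Epow_coord V) measurable_fst)].
by apply/funext => p; rewrite updzE.
Qed.

Lemma measurable_updzr z M : measurable_fun setT
  (updz z M : borel E -> Epow E (idx I)).
Proof.
apply: measurable_Epow => V.
rewrite (_ : (fun y => _) = fun y => if `[< val V = M >] then y else z V).
  by case: asboolP => _; [exact: measurable_id|exact: measurable_cst].
by apply/funext => y; rewrite updzE.
Qed.

Lemma measurable_rho r : measurable_fun setT (rho r : Epow E (idx I) -> Epow E (idx I)).
Proof.
elim: r => [|M r IHr] /=; first by apply: measurable_Epow => V; exact: measurable_coord.
have mp : measurable_fun setT ((fun z => (rho r z, coord z M)) :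
    Epow E (idx I) -> Epow E (idx I) * borel E).
  by apply/measurable_fun_pairP; split => //; exact: measurable_coord.
exact: (measurableT_comp (measurable_updz M) mp).
Qed.

Section Integrand.
Variable h : (idx I -> E) -> \bar R.
Hypotheses (mh : measurable_fun setT (h : Epow E (idx I) -> \bar R))
  (h0 : forall z, (0 <= h z)%E).

Lemma step_ge0 r M z : (0 <= step r M h z)%E.
Proof. by apply: integral_ge0 => y _. Qed.

Lemma measurable_step r M : measurable_fun setT (step r M h : Epow E (idx I) -> \bar R).
Proof.
pose l := kpull (trans P M (below I r M)) (measurable_restr_coord (J := Defs.AC I M (below I r M))).
exact: (@measurable_fun_integral_sfinite_kernel _ _ (Epow E (idx I)) (borel E) R
  (fun p => h (updz p.1 M p.2)) l (fun p => h0 _)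
  (measurableT_comp mh (measurable_updz M))).
Qed.

End Integrand.

Lemma chain_int_ge0 r h x : (forall z, (0 <= h z)%E) -> (0 <= chain_int r h x)%E.
Proof.
elim: r h => [h h0|M r IHr h h0] /=; first exact: h0.
by apply: IHr => z; exact: step_ge0.
Qed.

Lemma measurable_chain_int r h :
  measurable_fun setT (h : Epow E (idx I) -> \bar R) -> (forall z, (0 <= h z)%E) ->
  measurable_fun setT (chain_int r h : borel E -> \bar R).
Proof.
elim: r h => [h mh h0|M r IHr h mh h0] /=.
  have mcst : measurable_fun setT ((fun x => fun=> x) : borel E -> Epow E (idx I)).
    by apply: measurable_Epow.
  exact: (measurableT_comp mh mcst).
by apply: IHr; [exact: measurable_step|move=> z; exact: step_ge0].
Qed.

End StateSpace.

(** * The Markov property at a deterministic set *)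

Section SimpleMarkov.
Context (R : realType) (T : metricType R) (E : pmetricType R).
Context (I : indexing_collection T) (P : transition_system E I).
Variable th : shift_family I.
Hypothesis homP : shift_homogeneous P th.
Context d (Om : measurableType d) (Pr : probability Om R).
Variables (F : set T -> set (set Om)) (X : set T -> Om -> E).
Hypotheses (filtF : filtration I Pr F) (markovX : C_markov I Pr F X).
Hypothesis transX : has_transitions Pr X P.

Let adX : adapted I F X. Proof. by case: markovX. Qed.

Definition shifted (U : set T) (w : Om) : idx I -> E :=
  fun V => X (theta th U (val V)) w.

Lemma coord_shifted U V w : idx I V -> coord (shifted U w) V = X (theta th U V) w.
Proof. by move=> iV; rewrite (coord_restr (fun V => X (theta th U V) w)). Qed.

Lemma rhoE r (z : idx I -> E) (V : idx I) :
  rho r z V = coord z (if `[< dom I r (val V) >] then val V else bot I).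
Proof.
elim: r => [|M r IHr] /=; first by case: asboolP => [->|].
rewrite updzE IHr; case: asboolP => [->|VM]; first by rewrite asboolT//; left.
by congr (coord z _); congr (if _ then _ else _); apply: asbool_equiv_eq; split=> [|[]//]; right.
Qed.

Section OneStep.
Variables (U : set T) (r : seq (set T)) (M : set T).
Hypotheses (iU : idx I U) (cMr : chain I (M :: r)).
Local Notation B := (below I r M).
Local Notation thM := (theta th U M).
Local Notation thB := (theta_union th U B).

Let cr : chain I r. Proof. by case: cMr. Qed.
Let iM : idx I M. Proof. by case: cMr. Qed.

Let Gstar_past V K : dom I r V -> F (theta th U V) K -> Gstar I F thM thB K.
Proof.
move=> rV FK; have iV := dom_idx cr rV.
have ithV := theta_idx th iU iV.
apply: sub_sigma_algebra; exists (theta th U V); last by apply: (sub_ext_filt ithV).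
split; first exact: fin_union_idx.
rewrite -subset0 => x [Vx [Mx nBx]]; apply: nBx.
by apply: (theta_belowP cMr iU rV).
Qed.

Let measurable_shifted : measurable_fun setT (shifted U : Om -> Epow E (idx I)).
Proof.
apply: measurable_Epow => V; apply: (adapted_measurable filtF adX).
by apply: theta_idx => //; exact: set_valP.
Qed.

Let past w := rho r (shifted U w).

Let measurable_past : measurable_fun setT (past : Om -> Epow E (idx I)).
Proof. exact: (measurableT_comp (measurable_rho r) measurable_shifted). Qed.

Let Gstar_past_measurable (S : set (Epow E (idx I))) : measurable S ->
  Gstar I F thM thB (past @^-1` S).
Proof.
move=> mS; pose G := \bigcup_(B' in [set B' | fin_union I B' /\
  B' `&` (thM `\` thB) = set0]) ext_filt I F B'.
suff : measurable_fun setT (past : g_sigma_algebraType G -> Epow E (idx I)).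
  by move=> /(_ measurableT _ mS); rewrite setTI.
apply: (@measurable_Epow _ _ _ _ (g_sigma_algebraType G)) => V _ C mC; rewrite setTI.
set W := if `[< dom I r (val V) >] then val V else bot I.
have rW : dom I r W by rewrite /W; case: asboolP => // _; exact: dom_bot.
have iW := dom_idx cr rW.
rewrite (_ : _ @^-1` _ = X (theta th U W) @^-1` C).
  by apply: (Gstar_past rW); apply: adX => //; exact: theta_idx.
by apply/seteqP; split=> w /=; rewrite /past rhoE -/W coord_shifted.
Qed.

(* Only the section of the set along the coordinate M has to be a rectangle;
   this makes the class of such sets generate the whole sigma-field. *)
Let rect : set (set (Epow E (idx I))) := [set S : set (Epow E (idx I)) |
  measurable S /\ exists (S' : set (Epow E (idx I))) (G : set (borel E)),
    [/\ measurable S', measurable G &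
        forall (z : idx I -> E) (y : E), S (updz z M y) <-> S' z /\ G y]].

Let rect_gen : (measurable : set (set (Epow E (idx I)))) = <<s rect>>.
Proof.
apply/seteqP; split; last first.
  apply: smallest_sub; first exact: sigma_algebra_measurable.
  by move=> S [].
apply: sub_sigma_algebra2 => S [V [G mG SE]].
have mS : measurable (S : set (Epow E (idx I))).
  by apply: sub_sigma_algebra; exists V; exists G.
split => //; have [VM|VM] := pselect (val V = M).
  exists setT, G; split => // z y; rewrite SE /= updzE asboolT//.
  by split=> [|[]].
exists S, setT; split => // z y; rewrite SE /= updzE asboolF//.
by split=> [|[]].
Qed.

Let rectI : setI_closed rect.
Proof.
move=> S1 S2 [mS1 [S1' [G1 [mS1' mG1 S1E]]]] [mS2 [S2' [G2 [mS2' mG2 S2E]]]].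
split; first exact: measurableI.
exists (S1' `&` S2'), (G1 `&` G2); split; [exact: measurableI|exact: measurableI|].
move=> z y; split=> [[/S1E[? ?] /S2E[? ?]]//|[[? ?] [? ?]]].
by split; [apply/S1E|apply/S2E].
Qed.

Let rectT : rect setT.
Proof. by split => //; exists setT, setT; split. Qed.

Let transM w := trans P M B (restr (coord (past w))).

(** The candidate conditional law of the family with coordinate [M] added, given [past w]. *)
Let next w : giry (Epow E (idx I)) R := giry_map (measurable_updzr (past w) M)
  (giry_of (prob_kernel (s := trans P M B) (restr (coord (past w))))).

Let nextE w h : measurable_fun setT (h : Epow E (idx I) -> \bar R) ->
  (forall z, (0 <= h z)%E) -> (\int[next w]_z h z = step P r M h (past w))%E.
Proof. by move=> mh h0; exact: giry_int_map. Qed.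

(** By [integral_mixture] it suffices to test sets of [rect]. For these the event splits into one on
    [past], which together with [H] belongs to [Gstar], and one on the value at the shifted [M], to
    which [markov_transition] applies. *)
Lemma integral_one_step (H : set Om) (h : (idx I -> E) -> \bar R) : F U H ->
  measurable_fun setT (h : Epow E (idx I) -> \bar R) -> (forall z, (0 <= h z)%E) ->
  (\int[Pr]_(w in H) h (rho (M :: r) (shifted U w)) =
   \int[Pr]_(w in H) step P r M h (rho r (shifted U w)))%E.
Proof.
move=> FH mh h0.
have mH : measurable H by have [/(_ _ iU)[_ +] _ _] := filtF; apply.
have GH : Gstar I F thM thB H.
  by apply: (Gstar_past (dom_bot I r)); rewrite theta_of_bot.
transitivity (\int[Pr]_(w in H) \int[next w]_z h z)%E; last first.
  by apply: eq_integral => w _; rewrite nextE.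
apply: (integral_mixture (mu := Pr : giry Om R) rect_gen rectI rectT
  (Y := fun w => rho (M :: r) (shifted U w))) => //.
- exact: (measurableT_comp (measurable_rho (M :: r)) measurable_shifted).
- move=> S mS.
  have mind : measurable_fun setT ((fun z => (\1_S z)%:E) : Epow E (idx I) -> \bar R).
    by apply/measurable_EFinP; exact: measurable_indic.
  have ind0 (z : idx I -> E) : (0 <= (\1_S z)%:E :> \bar R)%E by rewrite lee_fin.
  rewrite (_ : next ^~ S = (step P r M (fun z => (\1_S z)%:E)) \o past).
    have ms := measurable_step P mind ind0 r M.
    have := measurableT_comp ms measurable_past.
    exact.
  by apply/funext => w /=; rewrite -nextE// integral_indic// setIT.
move=> S [mS [S' [G [mS' mG SE]]]].
have -> : H `&` (fun w => rho (M :: r) (shifted U w)) @^-1` S =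
    (H `&` past @^-1` S') `&` X thM @^-1` G.
  rewrite -setIA; congr (H `&` _).
  by apply/seteqP; split=> w /=; rewrite coord_shifted//; move/SE.
have inc := increment_theta_below cMr th iU.
rewrite [LHS](markov_transition filtF markovX transX inc _ mG); last first.
  apply: (@measurableI _ (g_sigma_algebraType _)) => //.
  exact: Gstar_past_measurable.
rewrite integral_mkcondr; apply: eq_integral => w _; rewrite patchE.
have nextS : next w S = transM w (updz (past w) M @^-1` S) by [].
rewrite nextS; case: ifPn => [|] wS'.
  have S'w : S' (past w) by exact: set_mem wS'.
  rewrite (_ : _ @^-1` S = G).
    have pastE V : Defs.AC I M B V -> coord (past w) V = X (theta th U V) w.
      move=> ACV; have rV := AC_below cMr ACV.
      by rewrite coord_rho// coord_shifted//; exact: (dom_idx cr rV).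
    (* Homogeneity with [X ^~ w] on the shifted side; by [pastE] its component at [theta th U V] is
       the coordinate V of [past w]. *)
    exact/esym/(@homP U M B iU (increment_below cMr) _ (X ^~ w) pastE G mG).
  by apply/seteqP; split=> y /=; [move/SE => []|move=> Gy; apply/SE].
rewrite (_ : _ @^-1` S = set0) ?measure0//.
rewrite -subset0 => y /= /SE[S'w _]; move: wS'; rewrite notin_setE; exact.
Qed.

End OneStep.

Lemma integral_simple_markov U r (H : set Om) (h : (idx I -> E) -> \bar R) :
  idx I U -> chain I r -> F U H ->
  measurable_fun setT (h : Epow E (idx I) -> \bar R) -> (forall z, (0 <= h z)%E) ->
  (\int[Pr]_(w in H) h (rho r (shifted U w)) =
   \int[Pr]_(w in H) chain_int P r h (X U w))%E.
Proof.
move=> iU; elim: r h => [h _ FH mh h0|M r IHr h cMr FH mh h0].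
  apply: eq_integral => w _ /=; congr (h _); apply/funext => V.
  by rewrite coord_shifted ?theta_of_bot//; exact: idx_bot.
rewrite integral_one_step// IHr//; first by case: cMr.
  exact: measurable_step.
by move=> z; exact: step_ge0.
Qed.

End SimpleMarkov.

(** * Continuity of the iterated integral *)

Section FellerChain.
Context (R : realType) (T : metricType R) (E : pmetricType R).
Hypotheses (lcE : locally_compact [set: E]) (sepE : separable E).
Context (I : indexing_collection T) (P : transition_system E I).
Hypothesis fellerP : forall f : E -> R, C0 f -> forall A B, increment I A B ->
  C0 (@transf _ _ _ _ P A B f : {ptws Defs.AC I A B -> E} -> R).
Local Notation Zt := {ptws idx I -> E}.

Lemma ptws_cvg (U J : Type) (G : set_system U) (f : U -> {ptws J -> E})
    (z : {ptws J -> E}) : Filter G ->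
  (forall V, (f u V : E) @[u --> G] --> (z V : E)) -> f u @[u --> G] --> z.
Proof.
move=> FG fV; apply/cvg_sup => V A [_ [[W oW <-] Wz]] /filterS; apply.
by apply: (fV V); exact: open_nbhs_nbhs.
Qed.

Lemma ptws_continuous (U : topologicalType) (J : Type) (f : U -> {ptws J -> E}) :
  (forall V, continuous (fun u => f u V : E)) -> continuous f.
Proof. by move=> fV u; apply: ptws_cvg => V; exact: fV. Qed.

Lemma ptws_eval_continuous (J : Type) (V : J) :
  continuous ((fun z => z V) : {ptws J -> E} -> E).
Proof.
move=> z; have /cvg_sup/(_ V) : nbhs (z : {ptws J -> E}) --> (z : {ptws J -> E}).
  exact: cvg_id.
move=> zV A nA; apply: zV.
exact: (@initial_continuous (J -> E) E (fun z => z V) z A nA).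
Qed.

Lemma updz_continuous M :
  continuous ((fun p => updz p.1 M p.2) : Zt * E -> Zt).
Proof.
apply: ptws_continuous => V.
rewrite (_ : (fun p => _) = fun p : Zt * E => if `[< val V = M >] then p.2 else (p.1 : idx I -> E) V).
  case: asboolP => _ p; first exact: cvg_snd.
  apply: (@continuous_comp _ _ _ (fst : Zt * E -> Zt) (fun z : Zt => z V)).
    exact: cvg_fst.
  exact: ptws_eval_continuous.
by apply/funext => p; rewrite updzE.
Qed.

Lemma rho_continuous r : continuous (rho r : Zt -> Zt).
Proof.
apply: ptws_continuous => V; rewrite (_ : (fun z => _) =
    fun z : Zt => coord z (if `[< dom I r (val V) >] then val V else bot I)).
  exact: ptws_eval_continuous.
by apply/funext => z; rewrite rhoE.
Qed.

(** Continuity and measurability are carried separately: on an uncountable product the product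
    sigma-field need not contain every open set. The bounds 0 and [c] survive because the kernels
    have mass 1. *)
Lemma step_continuous r M (h : (idx I -> E) -> R) (c : R) : chain I (M :: r) ->
  measurable_fun setT (h : Epow E (idx I) -> R) -> continuous (h : Zt -> R) ->
  (forall z, 0 <= h z <= c) ->
  exists h' : (idx I -> E) -> R,
  [/\ measurable_fun setT (h' : Epow E (idx I) -> R), continuous (h' : Zt -> R),
      forall z, 0 <= h' z <= c &
      forall z, step P r M (EFin \o h) z = (h' z)%:E].
Proof.
move=> cMr mh ch hc.
pose mu (z : idx I -> E) := trans P M (below I r M) (restr (coord z)).
have mu1 z : mu z setT = 1%E by exact: prob_kernel.
have mhz z : measurable_fun setT ((fun y => h (updz z M y)) : borel E -> R).
  exact: (measurableT_comp mh (measurable_updzr z M)).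
have hzi z : (mu z).-integrable setT (EFin \o (fun y => h (updz z M y)) : borel E -> \bar R).
  apply: (measure1_bounded_integrable (c := c)) => // y.
  by have /andP[h0 hc'] := hc (updz z M y); rewrite ger0_norm.
have stepE z : step P r M (EFin \o h) z = (\int[mu z]_y h (updz z M y))%:E.
  by rewrite /Rintegral fineK//; exact: integrable_fin_num (hzi z).
exists (fun z => \int[mu z]_y h (updz z M y)); split => //.
- have : measurable_fun setT (fine \o step P r M (EFin \o h) : Epow E (idx I) -> R).
    apply: measurableT_comp => //; apply: measurable_step; first exact/measurable_EFinP.
    by move=> z /=; rewrite lee_fin; case/andP: (hc z).
  by congr measurable_fun; apply/funext => z /=; rewrite stepE.
- apply: (@integral_weak_continuous _ E Zt lcE sepE mu (fun z y => h (updz z M y)) c) => //.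
    move=> f C0f; have [cf _] := fellerP C0f (increment_below cMr).
    move=> z; apply: (@continuous_comp _ _ _
      ((fun z => restr (coord z)) : Zt -> {ptws Defs.AC I M (below I r M) -> E}) _ _ _ (cf _)).
    by apply: ptws_continuous => V; exact: ptws_eval_continuous.
  move=> p; apply: (@continuous_comp _ _ _ ((fun p => updz p.1 M p.2) : Zt * E -> Zt) h).
    exact: updz_continuous.
  exact: ch.
- move=> z; rewrite Rintegral_ge0/=; last first.
    by move=> y _; case/andP: (hc (updz z M y)).
  have -> : c = \int[mu z]_y (cst c) y by rewrite Rintegral_cst// mu1 /= mulr1.
  apply: le_Rintegral => //; last by move=> y _; case/andP: (hc (updz z M y)).
  by apply: (measure1_bounded_integrable (c := `|c|)) => //; exact: measurable_cst.
Qed.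

Lemma chain_int_continuous r (h : (idx I -> E) -> R) (c : R) : chain I r ->
  measurable_fun setT (h : Epow E (idx I) -> R) -> continuous (h : Zt -> R) ->
  (forall z, 0 <= h z <= c) ->
  exists phi : E -> R,
  [/\ continuous phi, forall x, 0 <= phi x <= c &
      forall x, chain_int P r (EFin \o h) x = (phi x)%:E].
Proof.
elim: r h => [h _ mh ch hc|M r IHr h cMr mh ch hc].
  exists (fun x => h (fun=> x)); split => // x.
  apply: (@continuous_comp _ _ _ ((fun x => fun=> x) : E -> Zt) h); last exact: ch.
  by apply: ptws_continuous => V y; exact: cvg_id.
have [h' [mh' ch' hc' h'E]] := step_continuous cMr mh ch hc.
have cr : chain I r by case: cMr.
have [phi [cphi phic phiE]] := IHr h' cr mh' ch' hc'.
exists phi; split => // x; rewrite -phiE /=.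
by congr (chain_int P r _ x); apply/funext => z; exact: h'E.
Qed.

End FellerChain.

Lemma ge0_integral_finite_partition d (Om : measurableType d) (R : realType)
    (mu : {measure set Om -> \bar R}) (K : choiceType) (D : set K)
    (c : Om -> K) (H : set Om) (f g : Om -> \bar R) :
  finite_set D -> measurable H -> (forall U, D U -> measurable [set w | c w = U]) ->
  measurable_fun setT f -> measurable_fun setT g ->
  (forall w, 0 <= f w)%E -> (forall w, 0 <= g w)%E ->
  (forall U, D U -> \int[mu]_(w in H `&` [set w | c w = U]) f w =
                    \int[mu]_(w in H `&` [set w | c w = U]) g w)%E ->
  (\int[mu]_(w in H `&` [set w | D (c w)]) f w =
   \int[mu]_(w in H `&` [set w | D (c w)]) g w)%E.
Proof.
move=> + mH + mf mg f0 g0; move: D.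
apply: finite_set_ind_D1 => D fD IHD mc fg.
have [[U DU]|D0] := pselect (D !=set0); last first.
  rewrite (_ : _ `&` _ = set0) ?integral_set0//.
  by rewrite -subset0 => w [_ Dw]; apply: D0; exists (c w).
have split_D : H `&` [set w | D (c w)] =
    (H `&` [set w | c w = U]) `|` (H `&` [set w | (D `\ U) (c w)]).
  apply/seteqP; split=> [w [Hw Dw]|w [[Hw cU]|[Hw [Dw _]]]]; last first.
  - by [].
  - by split => //=; rewrite cU.
  have [cU|cU] := pselect (c w = U); first by left.
  by right.
have mDU V : (D `\ U) V -> measurable [set w | c w = V] by move=> [DV _]; exact: mc.
have m1 : measurable (H `&` [set w | c w = U]) by apply: measurableI => //; exact: mc.
have m2 : measurable (H `&` [set w | (D `\ U) (c w)]).
  apply: measurableI => //; rewrite (_ : mkset _ = \bigcup_(V in D `\ U) [set w | c w = V]).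
    by apply: fin_bigcup_measurable => //; exact: finite_setD.
  by apply/seteqP; split=> [w DUw|w [V DUV /= ->]//]; exists (c w).
have dis : [disjoint H `&` [set w | c w = U] & H `&` [set w | (D `\ U) (c w)]].
  by apply/eqP; rewrite -subset0 => w [[_ /= cU] [_ [_ /= ncU]]].
rewrite split_D !ge0_integral_setU//; [|exact: measurable_funTS|exact: measurable_funTS].
congr (_ + _)%E; first exact: fg.
by apply: IHD => // V [DV _]; exact: fg.
Qed.

(** * Finite-dimensional laws of the Markov family *)

Section Law.
Context (R : realType) (T : metricType R) (E : pmetricType R).
Context (I : indexing_collection T) (P : transition_system E I).
Variable th : shift_family I.
Hypothesis homP : shift_homogeneous P th.

Lemma dirac_law d (Om : measurableType d) (Pr : probability Om R)
    (Y : Om -> borel E) (x : E) (g : E -> \bar R) :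
  measurable_fun setT Y ->
  (forall G : set (borel E), measurable G -> Pr (Y @^-1` G) = \d_(x : borel E) G) ->
  measurable_fun setT (g : borel E -> \bar R) -> (forall y, 0 <= g y)%E ->
  (\int[Pr]_w g (Y w) = g x)%E.
Proof.
move=> mY YE mg g0.
rewrite -[LHS](giry_int_map mY (Pr : giry Om R) mg g0).
transitivity (\int[\d_(x : borel E)]_y g y)%E; last first.
  by rewrite integral_dirac// diracT mul1e.
by apply: eq_measure_integral => G mG _; exact: YE.
Qed.

(** The Markov property at [bot I], where the shift is the identity and the state is almost surely
    [x]. Hence the marginals depend only on [P] and [x], not on the process realizing the law. *)
Lemma integral_law (x : E) (Q : probability (Epow E (idx I)) R) r
    (h : (idx I -> E) -> \bar R) :
  law_from P x Q -> chain I r ->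
  measurable_fun setT (h : Epow E (idx I) -> \bar R) -> (forall z, (0 <= h z)%E) ->
  (\int[Q]_u h (rho r u) = chain_int P r h x)%E.
Proof.
move=> [d [Om [Pr [F [X [[_ filtF markovX transX initX] QE]]]]]] cr mh h0.
have mpath : measurable_fun setT (path_of X (idx I) : Om -> Epow E (idx I)).
  exact: path_measurable filtF markovX _ _.
have mhr : measurable_fun setT ((fun u => h (rho r u)) : Epow E (idx I) -> \bar R).
  exact: (measurableT_comp mh (measurable_rho r)).
transitivity (\int[giry_map mpath (Pr : giry Om R)]_u h (rho r u))%E.
  by apply: eq_measure_integral => S mS _; exact: QE.
rewrite -[LHS]/(giry_int _ _) giry_int_map//.
have -> : (fun u => h (rho r u)) \o path_of X (idx I) =
    fun w => h (rho r (shifted th X (bot I) w)).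
  apply/funext => w /=; congr (h (rho r _)); apply/funext => V.
  by rewrite /shifted theta_bot//; exact: set_valP.
have iB := idx_bot I.
have FT : F (bot I) setT.
  have [/(_ _ iB)[[F0 FC _] _] _ _] := filtF.
  by rewrite -(setD0 setT); exact: FC.
rewrite -[LHS]/(\int[Pr]_(w in setT) _)%E.
rewrite (integral_simple_markov homP filtF markovX transX iB cr FT mh h0).
apply: dirac_law.
- by apply: (adapted_measurable filtF) => //; case: markovX.
- exact: initX.
- exact: measurable_chain_int.
- by move=> y; exact: chain_int_ge0.
Qed.

End Law.

(** * The strong Markov property for continuous integrands *)

Section StrongMarkov.
Context (R : realType) (T : metricType R) (E : pmetricType R).
Hypotheses (lcE : locally_compact [set: E]) (sepE : separable E).
Context (I : indexing_collection T) (S : separability_from_above I).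
Context (P : transition_system E I) (th : shift_family I).
Hypothesis fellerP : forall f : E -> R, C0 f -> forall A B, increment I A B ->
  C0 (@transf _ _ _ _ P A B f : {ptws Defs.AC I A B -> E} -> R).
Hypothesis homP : shift_homogeneous P th.
Context d (Om : measurableType d) (Pr : probability Om R).
Variables (F : set T -> set (set Om)) (X : set T -> Om -> E).
Hypotheses (filtF : filtration I Pr F) (markovX : C_markov I Pr F X).
Hypotheses (transX : has_transitions Pr X P) (oX : outer_continuous I X).
Variable xi : Om -> set T.
Hypothesis stop_xi : simple_stopping_set I F xi.

Local Notation g := (gapp S).
Local Notation stopped := (stopped_field F S xi).

Let ixi w : idx I (xi w). Proof. by case: stop_xi. Qed.
Let adX : adapted I F X. Proof. by case: markovX. Qed.

Definition stopped_shift w : idx I -> E := shifted th X (xi w) w.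

Let good n : set (set T) := gapp_values S n `&` idx I.
Let finite_good n : finite_set (good n).
Proof. by apply: finite_setIl; exact: finite_gapp_values. Qed.

Let approx n w : idx I -> E := fun V =>
  if `[< good n (g n (xi w)) /\ setT w >] then X (theta th (g n (xi w)) (val V)) w
  else X (val V) w.

Let approx_good n w : good n (g n (xi w)) -> approx n w = shifted th X (g n (xi w)) w.
Proof. by move=> gw; apply/funext => V; rewrite /approx asboolT. Qed.

Let measurable_approx n : measurable_fun setT (approx n : Om -> Epow E (idx I)).
Proof.
apply: measurable_Epow => V; have iV : idx I (val V) by exact: set_valP.
apply: (@measurable_fun_glue _ _ Om (borel E) _ (fun w => g n (xi w)) (good n)
  setT (fun U w => X (theta th U (val V)) w) (X (val V))) => //.
- by move=> U _; rewrite setIT; exact: (measurable_gapp_eq S filtF stop_xi).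
- move=> U B [_ iU] mB; rewrite setIT; apply: measurableI.
    exact: (measurable_gapp_eq S filtF stop_xi).
  rewrite -[_ @^-1` _]setTI; apply: (adapted_measurable filtF adX) => //.
  exact: theta_idx.
- exact: (adapted_measurable filtF adX).
Qed.

Lemma measurable_stopped_shift :
  measurable_fun setT (stopped_shift : Om -> Epow E (idx I)).
Proof.
apply: measurable_Epow => V.
apply: (measurable_theta_stopping S th filtF adX oX stop_xi); exact: set_valP.
Qed.

Let approx_near w V (e : R) : 0 < e -> exists N, forall n, (N <= n)%N ->
  good n (g n (xi w)) /\ mdist (stopped_shift w V) (approx n w V) <= e.
Proof.
move=> e0; have iV : idx I (val V) by exact: set_valP.
have [N NP] := outer_continuous_gapp S th w oX (ixi w) iV e0.
exists N => n /NP[ig de]; have gn : good n (g n (xi w)).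
  by split => //; exact: gapp_valuesP.
by split => //; rewrite approx_good.
Qed.

Let approx_cvg w : (approx n w : {ptws idx I -> E}) @[n --> \oo] -->
  (stopped_shift w : {ptws idx I -> E}).
Proof.
apply: ptws_cvg => V A /nbhs_ballP[e /= e0 eA].
have e20 : 0 < e / 2%:R by rewrite divr_gt0.
have [N NP] := approx_near w V e20; exists N => // n /= /NP[_ de].
apply: eA; rewrite ballEmdist /=; apply: le_lt_trans de _.
by rewrite gtr_pMr// invf_lt1// ltr1n.
Qed.

Lemma integral_strong_markov r (H : set Om) (h : (idx I -> E) -> R) (c : R) :
  chain I r -> stopped H ->
  measurable_fun setT (h : Epow E (idx I) -> R) ->
  continuous (h : {ptws idx I -> E} -> R) -> (forall z, 0 <= h z <= c) ->
  (\int[Pr]_(w in H) (h (rho r (stopped_shift w)))%:E =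
   \int[Pr]_(w in H) chain_int P r (EFin \o h) (X (xi w) w))%E.
Proof.
move=> cr sH mh ch hc.
have mH : measurable H by case: sH.
have [phi [cphi phic phiE]] := chain_int_continuous lcE sepE fellerP cr mh ch hc.
(* Both sides become continuous functionals of the shifted family, so that a single limit argument,
   [lim_of], serves for both. *)
pose ev (z : idx I -> E) := phi (coord z (bot I)).
have mev : measurable_fun setT (ev : Epow E (idx I) -> R).
  exact: (measurableT_comp (continuous_borel_measurable cphi) (measurable_coord (bot I))).
have mhr : measurable_fun setT ((h \o rho r) : Epow E (idx I) -> R).
  exact: (measurableT_comp mh (measurable_rho r)).
have evE w : ev (stopped_shift w) = phi (X (xi w) w).
  rewrite /ev /stopped_shift coord_shifted ?theta_of_bot//; exact: idx_bot.
transitivity (\int[Pr]_(w in H) (ev (stopped_shift w))%:E)%E; last first.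
  by apply: eq_integral => w _; rewrite phiE evE.
have EFin_h : measurable_fun setT (EFin \o h : Epow E (idx I) -> \bar R).
  exact/measurable_EFinP.
have h0 z : (0 <= (EFin \o h) z)%E by rewrite lee_fin; case/andP: (hc z).
(* On [G n] the approximation is an indexing set. Every [w] belongs to [G n] from some n on, so the
   indicator disappears in the limit. *)
pose G n := [set w | good n (g n (xi w))].
have mgU n U : measurable [set w | g n (xi w) = U].
  exact: (measurable_gapp_eq S filtF stop_xi).
have mG n : measurable (G n).
  rewrite (_ : G n = \bigcup_(U in good n) [set w | g n (xi w) = U]).
    exact: fin_bigcup_measurable.
  by apply/seteqP; split=> [w Gw|w [U gU /= UE]]; [exists (g n (xi w))|rewrite /G /= UE].
have approx_eq n : (\int[Pr]_(w in H `&` G n) ((h \o rho r) (approx n w))%:E =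
    \int[Pr]_(w in H `&` G n) (ev (approx n w))%:E)%E.
  apply: (@ge0_integral_finite_partition _ _ _ _ _ (good n) (fun w => g n (xi w))) => //.
  - by apply/measurable_EFinP; exact: (measurableT_comp mhr (measurable_approx n)).
  - by apply/measurable_EFinP; exact: (measurableT_comp mev (measurable_approx n)).
  - by move=> w; exact: h0.
  - by move=> w; rewrite lee_fin; case/andP: (phic (coord (approx n w) (bot I))).
  move=> U gU; have [_ iU] := gU.
  have FU := stopped_gapp_eq_filt filtF stop_xi n iU sH.
  have := integral_simple_markov homP filtF markovX transX iU cr FU EFin_h h0.
  move=> markovU.
  transitivity (\int[Pr]_(w in H `&` [set w | g n (xi w) = U])
      (EFin \o h) (rho r (shifted th X U w)))%E.
    apply: eq_integral => w /set_mem[_ /= gwU].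
    by rewrite approx_good gwU.
  rewrite markovU; apply: eq_integral => w /set_mem[_ /= gwU].
  rewrite phiE /ev approx_good gwU// coord_shifted ?theta_of_bot//; exact: idx_bot.
have lim_of (k : (idx I -> E) -> R) : measurable_fun setT (k : Epow E (idx I) -> R) ->
    continuous (k : {ptws idx I -> E} -> R) -> (forall z, 0 <= k z <= c) ->
    (\int[Pr]_(w in H `&` G n) (k (approx n w))%:E @[n --> \oo] -->
     \int[Pr]_(w in H) (k (stopped_shift w))%:E)%E.
  move=> mk ck kc.
  have -> : (fun n => \int[Pr]_(w in H `&` G n) (k (approx n w))%:E)%E =
      (fun n => \int[Pr]_(w in H) (((fun w => k (approx n w)) \_ (G n)) w)%:E)%E.
    apply/funext => n; rewrite integral_mkcondr; apply: eq_integral => w _.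
    by rewrite !patchE; case: ifP.
  apply: (@measure1_dominated_cvg _ _ _ Pr H _ _ c) => //.
  - exact: probability_setT.
  - move=> n; apply/(measurable_restrictT _ (mG n)); apply: measurable_funTS.
    exact: (measurableT_comp mk (measurable_approx n)).
  - move=> n w; rewrite patchE; have /andP[k0 k1] := kc (approx n w).
    case: ifP => _; first by rewrite ger0_norm.
    by rewrite normr0 (le_trans k0).
  move=> w; have [N NP] := approx_near w (bot_pt I) ltr01.
  have : k (approx n w) @[n --> \oo] --> k (stopped_shift w).
    have cw := @approx_cvg w; have ckw := ck (stopped_shift w).
    by move=> A nA; exact: (cw _ (ckw A nA)).
  apply: cvg_trans; apply: near_eq_cvg; exists N => // n /= /NP[gw _].
  by rewrite patchE mem_set.
have chr : continuous (h \o rho r : {ptws idx I -> E} -> R).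
  move=> z; apply: (@continuous_comp _ _ _ (rho r : {ptws idx I -> E} ->
    {ptws idx I -> E}) h); last exact: ch.
  exact: rho_continuous.
have cev : continuous (ev : {ptws idx I -> E} -> R).
  move=> z; apply: (@continuous_comp _ _ _
    ((fun z => coord z (bot I)) : {ptws idx I -> E} -> E) phi); last exact: cphi.
  exact: ptws_eval_continuous.
have lim1 := lim_of (h \o rho r) mhr chr (fun z => hc (rho r z)).
have lim2 := lim_of ev mev cev (fun z => phic _).
move: lim1; rewrite (funext approx_eq) => lim1.
exact: cvg_unique lim1 lim2.
Qed.

End StrongMarkov.

(** * From continuous integrands to open cylinders *)

Section OpenCylinders.
Context (R : realType) (E : pmetricType R) (J : Type).
Implicit Types (s : seq (J * set E)) (u : J -> E).

(** A coordinate may occur several times, so concatenating lists is intersecting cylinders and a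
    pi-system results. *)
Definition cyl s : set (Epow E J) := [set u | forall p, List.In p s -> p.2 (u p.1)].

Lemma cyl_nil : cyl [::] = setT.
Proof. by apply/seteqP; split=> // u _ p []. Qed.

Lemma cyl_cons p s : cyl (p :: s) = (fun u => u p.1) @^-1` p.2 `&` cyl s.
Proof.
apply/seteqP; split=> [u us|u [up us] q [<-//|qs]]; last exact: us.
by split; [apply: us; left|move=> q qs; apply: us; right].
Qed.

Lemma cyl_cat s s' : cyl (s ++ s') = cyl s `&` cyl s'.
Proof.
elim: s => [|p s IHs]; first by rewrite cyl_nil setTI.
by rewrite cat_cons !cyl_cons IHs setIA.
Qed.

Fixpoint all_open s : Prop := if s is p :: s' then open p.2 /\ all_open s' else True.

Lemma all_open_cat s s' : all_open s -> all_open s' -> all_open (s ++ s').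
Proof. by elim: s => //= p s IHs [op /IHs{}IHs] /IHs; split. Qed.

Lemma cyl_measurable s : all_open s -> measurable (cyl s).
Proof.
elim: s => [_|p s IHs [op /IHs ms]]; first by rewrite cyl_nil.
rewrite cyl_cons; apply: measurableI => //.
have mp : measurable (p.2 : set (borel E)) by exact: sub_sigma_algebra.
by have := measurable_Epow_coord p.1 measurableT mp; rewrite setTI.
Qed.

Definition open_cylinders : set (set (Epow E J)) :=
  [set C | exists2 s, all_open s & C = cyl s].

Lemma open_cylindersI : setI_closed open_cylinders.
Proof.
move=> _ _ [s os ->] [s' os' ->]; exists (s ++ s'); first exact: all_open_cat.
by rewrite cyl_cat.
Qed.

Lemma open_cylindersT : open_cylinders setT.
Proof. by exists [::] => //; rewrite cyl_nil. Qed.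

Lemma open_cylinders_gen :
  (measurable : set (set (Epow E J))) = <<s open_cylinders>>.
Proof.
apply/seteqP; split; last first.
  apply: smallest_sub; first exact: sigma_algebra_measurable.
  by move=> _ [s os ->]; exact: cyl_measurable.
apply: smallest_sub; first exact: smallest_sigma_algebra.
move=> _ [V [G mG ->]].
suff mV : measurable_fun setT ((fun u => u V) : g_sigma_algebraType open_cylinders -> borel E).
  by have := mV measurableT G mG; rewrite setTI.
apply: (@measurability _ _ _ (borel E) setT _ (@open E)) => // _ [A oA <-].
rewrite setTI; apply: sub_sigma_algebra; exists [:: (V, A)] => //.
by rewrite cyl_cons cyl_nil setIT.
Qed.

Variable phi : set E -> nat -> E -> R.
Hypothesis phiP : forall O, open O -> [/\ forall n, continuous (phi O n),
  forall n x, 0 <= phi O n x <= 1 &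
  forall x, exists N, forall n, (N <= n)%N -> phi O n x = \1_O x].

Fixpoint bump_prod s (n : nat) u : R :=
  if s is p :: s' then phi p.2 n (u p.1) * bump_prod s' n u else 1.

Lemma bump_prod01 s n u : all_open s -> 0 <= bump_prod s n u <= 1.
Proof.
elim: s => [_|p s IHs /= [/phiP[_ p01 _] /IHs/andP[b0 b1]]] /=; first by rewrite ler01 lexx.
have /andP[p0 p1] := p01 n (u p.1).
by rewrite mulr_ge0//= mulr_ile1.
Qed.

Lemma bump_prod_measurable s n : all_open s ->
  measurable_fun setT (bump_prod s n : Epow E J -> R).
Proof.
elim: s => [_|p s IHs /= [/phiP[cp _ _] /IHs mb]] /=; first exact: measurable_cst.
apply: measurable_funM => //.
apply: (measurableT_comp (continuous_borel_measurable (cp n))).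
exact: measurable_Epow_coord.
Qed.

Lemma bump_prod_continuous s n : all_open s ->
  continuous (bump_prod s n : {ptws J -> E} -> R).
Proof.
elim: s => [_|p s IHs /= [/phiP[cp _ _] /IHs cb]] /=; first exact: cst_continuous.
have cV : continuous ((fun u => phi p.2 n (u p.1)) : {ptws J -> E} -> R).
  move=> u; apply: (@continuous_comp _ _ _ ((fun u => u p.1) : {ptws J -> E} -> E)
    (phi p.2 n)); last exact: cp.
  exact: ptws_eval_continuous.
move=> u.
exact: (@cvgM R {ptws J -> E} (nbhs (u : {ptws J -> E})) _
  (fun u => phi p.2 n (u p.1)) (fun u => bump_prod s n u) _ _ (cV u) (cb u)).
Qed.

Lemma bump_prod_lim s u : all_open s ->
  exists N, forall n, (N <= n)%N -> bump_prod s n u = \1_(cyl s) u.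
Proof.
elim: s => [_|p s IHs /= [/phiP[_ _ lp] /IHs[N NP]]].
  by exists 0%N => n _ /=; rewrite cyl_nil indicT.
have [N' NP'] := lp (u p.1); exists (maxn N N') => n; rewrite geq_max => /andP[Nn N'n].
by rewrite /= NP// NP'// cyl_cons indicI.
Qed.

Lemma bump_prod_cvg s u : all_open s ->
  bump_prod s n u @[n --> \oo] --> (\1_(cyl s) u : R).
Proof.
move=> os; have [N NP] := bump_prod_lim u os; apply: cvg_near_cst.
by exists N => // n /= /NP.
Qed.

End OpenCylinders.

Section RhoCylinder.
Context (R : realType) (T : metricType R) (E : pmetricType R).
Context (I : indexing_collection T).
Variables (r : seq (set T)) (s : seq (idx I * set E)).
Hypotheses (cr : chain I r) (rs : forall p, List.In p s -> dom I r (val p.1)).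

Lemma rho_coord_in p (u : idx I -> E) : List.In p s -> rho r u p.1 = u p.1.
Proof.
by move=> ps; rewrite -[LHS](coordK (rho r u)) coord_rho ?coordK//; exact: rs.
Qed.

Lemma cyl_rho u : cyl s (rho r u) <-> cyl s u.
Proof.
by split=> us p ps; have := us p ps; rewrite rho_coord_in.
Qed.

End RhoCylinder.

Lemma bump_prod_rho (R : realType) (T : metricType R) (E : pmetricType R)
    (I : indexing_collection T) phi r (s : seq (idx I * set E)) n u :
  chain I r -> (forall p, List.In p s -> dom I r (val p.1)) ->
  bump_prod phi s n (rho r u) = bump_prod phi s n u.
Proof.
move=> cr; elim: s => //= p s IHs rs.
rewrite (rho_coord_in (s := p :: s) cr rs); last by left.
by rewrite IHs// => q qs; apply: rs; right.
Qed.

Section MarkovFamily.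
Context (R : realType) (T : metricType R) (E : pmetricType R).
Context (I : indexing_collection T) (P : transition_system E I).
Variables (th : shift_family I).
Hypothesis homP : shift_homogeneous P th.
Variable Px : E -> probability (Epow E (idx I)) R.
Hypothesis PxP : forall x, law_from P x (Px x).

Lemma chain_for (s : seq (idx I * set E)) :
  exists2 r, chain I r & forall p, List.In p s -> dom I r (val p.1).
Proof.
have [|r cr rs] := @chain_cover _ _ I (map (fun p => val p.1) s).
  by elim: s => //= p s IHs A [<-|/IHs//]; exact: set_valP.
exists r => // p ps; apply: rs.
by elim: s ps => //= q s IHs [->|/IHs]; [left|right].
Qed.

(** Measurability in the initial state is not part of [law_from]. On cylinders the probability is an
    iterated integral, and Dynkin induction does the rest. *)
Lemma measurable_law (C : set (Epow E (idx I))) : measurable C ->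
  measurable_fun setT ((fun x => Px x C) : borel E -> \bar R).
Proof.
rewrite (open_cylinders_gen E (idx I)); move: C.
apply: (dynkin_induction (open_cylinders_gen E (idx I)) (@open_cylindersI _ E (idx I))
  (P := fun C => measurable_fun setT ((fun x => Px x C) : borel E -> \bar R))).
- by under eq_fun do rewrite probability_setT; exact: measurable_cst.
- move=> _ [s os ->]; have [r cr rs] := chain_for s.
  have mind : measurable_fun setT (EFin \o \1_(cyl s) : Epow E (idx I) -> \bar R).
    by apply/measurable_EFinP; apply: measurable_indic; exact: cyl_measurable.
  have ind0 z : (0 <= (EFin \o \1_(cyl s)) z :> \bar R)%E by rewrite lee_fin.
  rewrite (_ : (fun x => _) = chain_int P r (EFin \o \1_(cyl s))).
    exact: measurable_chain_int.
  apply/funext => x; rewrite -(integral_law homP (PxP x) cr mind ind0).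
  transitivity (\int[Px x]_u (\1_(cyl s) u)%:E)%E.
    by rewrite integral_indic ?setIT//; exact: cyl_measurable.
  apply: eq_integral => u _; congr EFin; rewrite /= !indicE; congr ((nat_of_bool _)%:R).
  by apply/idP/idP => /set_mem us; apply: mem_set; apply/(cyl_rho cr rs).
- move=> D mD mPD; rewrite (_ : (fun x => _) = (fun x => 1 - Px x D)%E).
    by apply: emeasurable_funB => //; exact: measurable_cst.
  by apply/funext => x; rewrite probability_setC.
- move=> D mD tD mPD; rewrite (_ : (fun x => _) = (fun x => \sum_(0 <= k <oo) Px x (D k))%E).
    by apply: ge0_emeasurable_sum => // k x _ _; exact: measure_ge0.
  by apply/funext => x; rewrite measure_bigcup//; apply: eq_eseriesl => k; rewrite in_setT.
Qed.

End MarkovFamily.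

(** * The strong Markov property for nonnegative measurable functions *)

Section StrongMarkovLaw.
Context (R : realType) (T : metricType R) (E : pmetricType R).
Hypotheses (lcE : locally_compact [set: E]) (sepE : separable E).
Context (I : indexing_collection T) (S : separability_from_above I).
Context (P : transition_system E I) (th : shift_family I).
Hypothesis fellerP : forall f : E -> R, C0 f -> forall A B, increment I A B ->
  C0 (@transf _ _ _ _ P A B f : {ptws Defs.AC I A B -> E} -> R).
Hypothesis homP : shift_homogeneous P th.
Variable Px : E -> probability (Epow E (idx I)) R.
Hypothesis PxP : forall x, law_from P x (Px x).
Context d (Om : measurableType d) (Pr : probability Om R).
Variables (F : set T -> set (set Om)) (X : set T -> Om -> E).
Hypotheses (filtF : filtration I Pr F) (markovX : C_markov I Pr F X).
Hypotheses (transX : has_transitions Pr X P) (oX : outer_continuous I X).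
Variable xi : Om -> set T.
Hypothesis stop_xi : simple_stopping_set I F xi.

Local Notation stopped := (stopped_field F S xi).
Local Notation Y := (stopped_shift th X xi).

Let adX : adapted I F X. Proof. by case: markovX. Qed.

Lemma measurable_stopped_value :
  measurable_fun setT ((fun w => X (xi w) w) : Om -> borel E).
Proof.
have := measurable_theta_stopping S th filtF adX oX stop_xi (idx_bot I).
by congr measurable_fun; apply/funext => w; rewrite theta_of_bot//; case: stop_xi.
Qed.

Let measurable_Y : measurable_fun setT (Y : Om -> Epow E (idx I)).
Proof. exact: (measurable_stopped_shift S th filtF markovX oX stop_xi). Qed.

Lemma stopped_shift_cyl (s : seq (idx I * set E)) (H : set Om) :
  stopped H -> all_open s ->
  (Pr (H `&` Y @^-1` cyl s) = \int[Pr]_(w in H) Px (X (xi w) w) (cyl s))%E.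
Proof.
move=> sH os; have [r cr rs] := chain_for s.
have mH : measurable H by case: sH.
have mS := cyl_measurable os.
have [phi phiP] : exists phi : set E -> nat -> E -> R, forall O, open O ->
    [/\ forall n, continuous (phi O n), forall n x, 0 <= phi O n x <= 1 &
        forall x, exists N, forall n, (N <= n)%N -> phi O n x = \1_O x].
  have /choice[phi phiP] : forall O : set E, exists p : nat -> E -> R, open O ->
      [/\ forall n, continuous (p n), forall n x, 0 <= p n x <= 1 &
          forall x, exists N, forall n, (N <= n)%N -> p n x = \1_O x].
    move=> O; have [oO|nO] := pselect (open O); last by exists (fun _ _ => 0) => /nO.
    by have [p [cp _ p01 lp]] := open_bumps lcE sepE oO; exists p.
  by exists phi.
pose b n := bump_prod phi s n.
have mb n : measurable_fun setT (b n : Epow E (idx I) -> R) by exact: bump_prod_measurable.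
have cb n : continuous (b n : {ptws idx I -> E} -> R) by exact: bump_prod_continuous.
have b01 n u : 0 <= b n u <= 1 by exact: bump_prod01.
have b_norm n u : `|b n u| <= 1 by have /andP[b0 b1] := b01 n u; rewrite ger0_norm.
have bu u : b n u @[n --> \oo] --> (\1_(cyl s) u : R) by exact: bump_prod_cvg.
have /choice[psi psiP] : forall n, exists psi : E -> R,
    [/\ continuous psi, forall x, 0 <= psi x <= 1 &
        forall x, chain_int P r (EFin \o b n) x = (psi x)%:E].
  move=> n; exact: (chain_int_continuous lcE sepE fellerP cr (mb n) (cb n) (b01 n)).
have psiE n x : (\int[Px x]_u (b n u)%:E = (psi n x)%:E)%E.
  have [_ _ <-] := psiP n.
  rewrite -(integral_law homP (PxP x) cr); last 2 first.
  - by apply/measurable_EFinP; exact: mb.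
  - by move=> z /=; rewrite lee_fin; case/andP: (b01 n z).
  by apply: eq_integral => u _ /=; rewrite /b bump_prod_rho.
have fin_Px x : Px x (cyl s) \is a fin_num by exact: fin_num_measure.
(* By [psiE] the number [psi n x] is an integral under the fixed law [Px x], so dominated
   convergence finds its limit for each x. *)
have psi_cvg x : psi n x @[n --> \oo] --> fine (Px x (cyl s)).
  have : ((psi n x)%:E @[n --> \oo] --> (fine (Px x (cyl s)))%:E)%E.
    have := @measure1_dominated_cvg _ _ _ (Px x) setT b (\1_(cyl s)) 1
      (probability_setT _) measurableT mb b_norm bu.
    rewrite integral_indic// setIT fineK//.
    by under eq_fun do rewrite psiE.
  by move/fine_cvgP => [_].
have psi_norm n x : `|psi n x| <= 1.
  by have [_ /(_ x)/andP[p0 p1] _] := psiP n; rewrite ger0_norm.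
have eq_n n : (\int[Pr]_(w in H) (b n (Y w))%:E =
    \int[Pr]_(w in H) (psi n (X (xi w) w))%:E)%E.
  have := integral_strong_markov lcE sepE fellerP homP filtF markovX transX oX
    stop_xi cr sH (mb n) (cb n) (b01 n).
  under eq_integral do rewrite /b (bump_prod_rho _ _ _ cr rs).
  move=> ->; apply: eq_integral => w _.
  by have [_ _ ->] := psiP n.
have lim_b : (\int[Pr]_(w in H) (b n (Y w))%:E @[n --> \oo] -->
    \int[Pr]_(w in H) (\1_(cyl s) (Y w))%:E)%E.
  apply: (@measure1_dominated_cvg _ _ _ Pr H (fun n w => b n (Y w)) _ 1) => //.
    exact: probability_setT.
  by move=> n; exact: (measurableT_comp (mb n) measurable_Y).
have lim_psi : (\int[Pr]_(w in H) (psi n (X (xi w) w))%:E @[n --> \oo] -->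
    \int[Pr]_(w in H) (fine (Px (X (xi w) w) (cyl s)))%:E)%E.
  apply: (@measure1_dominated_cvg _ _ _ Pr H (fun n w => psi n (X (xi w) w)) _ 1) => //.
    exact: probability_setT.
  move=> n; have [cp _ _] := psiP n.
  exact: (measurableT_comp (continuous_borel_measurable cp) measurable_stopped_value).
move: lim_b; rewrite (funext eq_n) => lim_b.
have mYS : measurable (Y @^-1` cyl s) by rewrite -[_ @^-1` _]setTI; exact: measurable_Y.
transitivity (\int[Pr]_(w in H) (\1_(cyl s) (Y w))%:E)%E.
  by rewrite setIC -integral_indic.
rewrite (cvg_unique _ lim_b lim_psi)//.
by apply: eq_integral => w _; rewrite fineK.
Qed.

Lemma integral_stopped_shift (H : set Om) (h : (idx I -> E) -> \bar R) :
  stopped H -> measurable_fun setT (h : Epow E (idx I) -> \bar R) ->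
  (forall z, 0 <= h z)%E ->
  (\int[Pr]_(w in H) h (Y w) = \int[Pr]_(w in H) \int[Px (X (xi w) w)]_u h u)%E.
Proof.
move=> sH mh h0; have mH : measurable H by case: sH.
have mlaw C : measurable C -> measurable_fun setT
    ((fun w => (Px (X (xi w) w) : giry (Epow E (idx I)) R)) ^~ C).
  move=> mC.
  exact: (measurableT_comp (measurable_law homP PxP mC) measurable_stopped_value).
have cylE (C : set (Epow E (idx I))) : open_cylinders C ->
    (Pr (H `&` Y @^-1` C) = \int[Pr]_(w in H) Px (X (xi w) w) C)%E.
  by move=> [s os ->]; exact: stopped_shift_cyl.
exact: (@integral_mixture _ _ Om (Epow E (idx I)) R (Pr : giry Om R)
  (@open_cylinders _ E (idx I)) (@open_cylinders_gen _ E (idx I))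
  (@open_cylindersI _ E (idx I)) (@open_cylindersT _ E (idx I)) H Y
  (fun w => Px (X (xi w) w) : giry (Epow E (idx I)) R) h mH measurable_Y mlaw cylE mh h0).
Qed.

Lemma stopped_integral_law (h : (idx I -> E) -> \bar R) :
  measurable_fun setT (h : Epow E (idx I) -> \bar R) -> (forall z, 0 <= h z)%E ->
  forall G : set (\bar R), measurable G ->
  stopped ((fun w => \int[Px (X (xi w) w)]_u h u)%E @^-1` G).
Proof.
move=> mh h0 G mG.
have mint : measurable_fun setT ((fun x => \int[Px x]_u h u)%E : borel E -> \bar R).
  apply: (@measurable_fun_integral_kernel _ _ (borel E) (Epow E (idx I)) R
    (fun x => Px x : {measure set _ -> \bar R})) => //.
  by move=> U mU; exact: (measurable_law homP PxP mU).
have := mint measurableT _ mG; rewrite setTI.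
exact: (stopped_measurable S th filtF adX oX stop_xi).
Qed.

End StrongMarkovLaw.

Theorem theorem2p6
  (R : realType) (T : metricType R) (E : pmetricType R)
  (locally_compact_T : locally_compact [set: T])
  (locally_compact_E : locally_compact [set: E])
  (separable_E : separable E)
  (I : indexing_collection T) (S : separability_from_above I) (N : pairing I)
  (P : transition_system E I) (feller_P : feller P N)
  (th : shift_family I) (homogeneous_P : shift_homogeneous P th)
  (Px : E -> probability (Epow E (idx I)) R)
  (PxP : forall x, law_from P x (Px x))
  (nu : probability (borel E) R)
  (d : measure_display) (Om : measurableType d) (Pnu : probability Om R)
  (F : set T -> set (set Om)) (X : set T -> Om -> E)
  (markov_X : markov_under Pnu F X P nu)
  (outer_continuous_X : outer_continuous I X)
  (xi : Om -> set T)
  (stopping_xi : simple_stopping_set I F xi)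
  (bounded_xi : bounded_stopping_set I Pnu xi)
  (f : Epow E (idx I) -> R) (measurable_f : measurable_fun setT f)
  (f_ge0 : forall w, 0 <= f w) :
  exists W : Om -> \bar R,
    is_cond_exp Pnu (stopped_field F S xi)
      (fun w => (f (fun V : idx I => X (theta th (xi w) (val V)) w))%:E) W /\
    {ae Pnu, forall w, W w = (\int[Px (X (xi w) w)]_u (f u)%:E)%E}.
Proof.
case: markov_X => _ filtF markovX transX _.
case: feller_P => fellerP _.
have mf : measurable_fun setT (fun u : Epow E (idx I) => (f u)%:E).
  exact/measurable_EFinP.
have f0 (u : idx I -> E) : (0 <= (f u)%:E)%E by rewrite lee_fin; exact: f_ge0.
have mY := measurable_stopped_shift S th filtF markovX outer_continuous_X stopping_xi.
(* The right-hand side itself serves as the version, so the almost sure equality holds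
   everywhere. *)
exists (fun w => (\int[Px (X (xi w) w)]_u (f u)%:E)%E); split; last exact: aeW.
split.
- exact: (measurableT_comp mf mY).
- exact: (stopped_integral_law (h := fun u => (f u)%:E) S homogeneous_P PxP filtF markovX
    outer_continuous_X stopping_xi mf f0).
- move=> H sH; apply/esym.
  exact: (integral_stopped_shift (h := fun u => (f u)%:E) locally_compact_E separable_E
    fellerP homogeneous_P PxP filtF markovX transX outer_continuous_X stopping_xi sH mf f0).
Qed.
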